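(* Let $\mathbb D\subset\mathbb C$ be the open unit disc, and for $\lambda\in\mathbb D$ let $f_0=f_{0,\lambda}$ and $f_1=f_{1,\lambda}$ be rational functions on $\widehat{\mathbb C}$ depending analytically on $\lambda$. Let $p_0,p_1\in(0,1)$ with $p_0+p_1=1$. Assume that for every $\lambda\in\mathbb D$: (a) $0$ is a fixed point of both $f_0$ and $f_1$; writing $\mu(\lambda)=f_{0,\lambda}'(0)$ and $\nu(\lambda)=f_{1,\lambda}'(0)$, one has $|\mu(\lambda)|>1$ and $|\nu(\lambda)|<1$; (b) $\infty$ is a superattracting fixed point of $f_0$, the local degree of $f_0$ at $\infty$ being $d\ge 2$, and $f_1(\infty)=0$; (c) $f_0$ is hyperbolic, and every attracting fixed or periodic point of $f_0$ other than $\infty$ is mapped into the immediate basin of $\infty$ for $f_0$ by some iterate $f_1^k$; (d) $p_0\ln|\mu(\lambda)|+p_1\ln|\nu(\lambda)|>0$ (with $\ln 0=-\infty$). Then for each $\lambda\in\mathbb D$ the action of the semigroup $G_\lambda=\langle f_0,f_1\rangle$ on $\widehat{\mathbb C}$ is topologically transitive, i.e. for all non-empty open sets $U,V\subset\widehat{\mathbb C}$ there exists $g\in G_\lambda$ with $g(U)\cap V\neq\emptyset$.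
   Context: $\widehat{\mathbb C}$ is the Riemann sphere. $\langle f_0,f_1\rangle$ is the semigroup of compositions of $f_0$ and $f_1$. A rational map (of degree at least $2$) is hyperbolic if each of its critical points converges under iteration to an attracting (possibly superattracting) periodic cycle. The immediate basin of $\infty$ for $f_0$ is the connected component containing $\infty$ of the basin of attraction of $\infty$ under $f_0$. The numbers $p_0,p_1$ are the probabilities with which $f_0,f_1$ are chosen in the associated iterated function system; here they enter only through (d). *)

(* Defs.v *)
From HB Require Import structures.
From mathcomp Require Import all_boot all_order all_algebra.
From mathcomp Require Import all_classical all_reals all_analysis.
From mathcomp Require Export complex.

Set Implicit Arguments.
Unset Strict Implicit.
Unset Printing Implicit Defensive.

Import Order.TTheory GRing.Theory Num.Theory.
Import numFieldNormedType.Exports.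

Local Open Scope classical_set_scope.
Local Open Scope ring_scope.
Local Open Scope complex_scope.

(* The topology of R[i] is the one induced by its modulus: it is the generic
   normed-module structure of a numFieldType over itself, which is not found
   by unification on the concrete type R[i]. *)
HB.instance Definition _ (R : realType) := NormedModule.copy R[i] R[i]^o.

Definition sphere (R : realType) := one_point_compactification R[i].

HB.instance Definition _ (R : realType) := Topological.on (sphere R).

Definition fin_pt (R : realType) (z : R[i]) : sphere R := Some z.
Definition infty_pt (R : realType) : sphere R := None.
Arguments infty_pt {R}.

(* For p and q coprime with q != 0, the self-map of the sphere defined by p/q;
   its value at infinity is the limit of p(z)/q(z) as z tends to infinity. *)
Definition ratmap (R : realType) (p q : {poly R[i]}) (x : sphere R) :
    sphere R :=
  match x with
  | Some z => if q.[z] == 0 then infty_pt else fin_pt (p.[z] / q.[z])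
  | None => if (size q < size p)%N then infty_pt
            else fin_pt (p`_(size q).-1 / lead_coef q)
  end.

(* Recall that size p is the degree of p plus one. *)
Definition rational_map_of_degree (R : realType) (n : nat)
    (f : sphere R -> sphere R) : Prop :=
  exists p q : {poly R[i]},
    [/\ coprimep p q, q != 0, f = ratmap p q &
        (maxn (size p) (size q)).-1 = n].

Definition is_rational_map (R : realType) (f : sphere R -> sphere R) : Prop :=
  exists n : nat, rational_map_of_degree n f.

(* sphere_param a is a local parametrization of the sphere centered at a
   (sending 0 to a), and sphere_coord a is the corresponding local coordinate.
   The coordinate takes the junk value 0 at the single point outside the
   image of the parametrization: infinity if a is finite, 0 if a is infinity
   (recall that 0^-1 = 0). *)
Definition sphere_param (R : realType) (a : sphere R) (h : R[i]) : sphere R :=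
  match a with
  | Some z => fin_pt (z + h)
  | None => if h == 0 then infty_pt else fin_pt h^-1
  end.

Definition sphere_coord (R : realType) (a x : sphere R) : R[i] :=
  match a, x with
  | Some z, Some w => w - z
  | None, Some w => w^-1
  | _, None => 0
  end.

Definition local_expr (R : realType) (f : sphere R -> sphere R)
    (a : sphere R) (h : R[i]) : R[i] :=
  sphere_coord (f a) (f (sphere_param a h)).

(* The charts at a and at f a being the same when a is a fixed point of f,
   sphere_deriv f a is then the multiplier of f at a; for a = fin_pt z with
   f a finite it is the usual derivative. *)
Definition sphere_deriv (R : realType) (f : sphere R -> sphere R)
    (a : sphere R) : R[i] :=
  derive1 (local_expr f a) 0.

Definition critical_point (R : realType) (f : sphere R -> sphere R)
    (a : sphere R) : Prop :=
  sphere_deriv f a = 0.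

(* In local coordinates centered at a and f a, f is c h^d + o(h^d), c != 0. *)
Definition local_degree (R : realType) (f : sphere R -> sphere R)
    (a : sphere R) (d : nat) : Prop :=
  (0 < d)%N /\
  exists2 c : R[i], c != 0 & local_expr f a h / h ^+ d @[h --> 0^'] --> c.

Definition superattracting_fixed (R : realType) (f : sphere R -> sphere R)
    (a : sphere R) : Prop :=
  f a = a /\ sphere_deriv f a = 0.

(* Fixed points are included (n = 1).  The period n need not be minimal; by
   the chain rule this does not affect the condition on the multiplier. *)
Definition attracting_periodic (R : realType) (f : sphere R -> sphere R)
    (a : sphere R) : Prop :=
  exists n : nat,
    [/\ (0 < n)%N, iter n f a = a & `|sphere_deriv (iter n f) a| < 1].

Definition forward_orbit (R : realType) (f : sphere R -> sphere R)
    (a : sphere R) : set (sphere R) :=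
  range (fun j : nat => iter j f a).

Definition hyperbolic (R : realType) (f : sphere R -> sphere R) : Prop :=
  (exists2 n : nat, (2 <= n)%N & rational_map_of_degree n f) /\
  forall c, critical_point f c ->
    exists2 a, attracting_periodic f a &
      (fun k : nat => iter k f c) @ \oo `=>` set_nbhs (forward_orbit f a).

Definition immediate_basin_infty (R : realType) (f : sphere R -> sphere R) :
    set (sphere R) :=
  connected_component
    [set x | (fun k : nat => iter k f x) @ \oo --> (infty_pt : sphere R)]
    infty_pt.

(* (l, x) |-> F l x is a holomorphic map from the product of the unit disc
   and the sphere to the sphere: it is continuous and, read in local
   coordinates, complex differentiable in both variables jointly. *)
Definition analytic_on_disc (R : realType)
    (F : R[i] -> sphere R -> sphere R) : Prop :=
  forall (l : R[i]) (a : sphere R), `|l| < 1 ->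
    {for (l, a), continuous (fun u : R[i] * sphere R => F u.1 u.2)} /\
    differentiable
      (fun v : R[i] * R[i] =>
         sphere_coord (F l a) (F (l + v.1) (sphere_param a v.2)))
      ((0, 0) : R[i] * R[i]).

Definition analytic_rational_family (R : realType)
    (F : R[i] -> sphere R -> sphere R) : Prop :=
  (forall l : R[i], `|l| < 1 -> is_rational_map (F l)) /\ analytic_on_disc F.

Inductive semigroup_gen (T : Type) (f0 f1 : T -> T) : (T -> T) -> Prop :=
| SemigroupGen0 : semigroup_gen f0 f1 f0
| SemigroupGen1 : semigroup_gen f0 f1 f1
| SemigroupComp g h :
    semigroup_gen f0 f1 g -> semigroup_gen f0 f1 h ->
    semigroup_gen f0 f1 (g \o h).

Definition topologically_transitive (T : topologicalType)
    (G : set (T -> T)) : Prop :=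
  forall U V : set T, open U -> open V -> U !=set0 -> V !=set0 ->
    exists2 g, G g & (g @` U) `&` V !=set0.

(* Main.v *)
Require Import Defs.
From HB Require Import structures.
From mathcomp Require Import all_boot all_order all_algebra.
From mathcomp Require Import all_classical all_reals all_analysis.
From mathcomp Require Import complex.
From mathcomp Require Import cyclic separable cyclotomic.
From mathcomp Require Import ring lra zify.

(* Suppose that the images of the open set U under the semigroup miss a disc
   B(v, r).  In the coordinate 1 / (x - v) they are bounded, so Cauchy's
   estimate bounds |g'(z)| for z in U by a constant depending only on |g(z)|.
   It suffices to find elements g of the semigroup whose values at some z in U
   stay bounded while their derivatives do not.

   Let N be a closed neighbourhood of infinity and of attracting cycles which
   f0 maps into its interior and which contains the critical values of f0 in
   its interior.

   If some point of U enters N under f0, hypothesis (c) brings it near infinity.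
   There the logarithmic derivative z f0'(z) / f0(z) has modulus at least 3/2,
   so it blows up along f0^j; f1 then sends the orbit near 0, and it is driven
   back to a fixed distance from 0 by the repelling fixed point 0 of f0, which
   distorts logarithmic derivatives by a bounded factor only.

   Otherwise the orbit of z in U stays in the complement D of N.  A disc in D
   centered at f0(z) lifts through f0 to a disc centered at z, and tilting it
   by a linear term, there being room between f0^-1(D) and the boundary of D,
   increases its derivative by a fixed amount.  By Schwarz's lemma the
   derivatives of discs in D are bounded, so the derivatives of the iterates
   of f0 at z are not.

   All discs are uniform limits of polynomials on the closed unit disc, so that
   averages over roots of unity replace Cauchy's formula and Newton's iteration
   replaces the monodromy theorem. *)

Set Implicit Arguments.
Unset Strict Implicit.
Unset Printing Implicit Defensive.

Import Order.TTheory GRing.Theory Num.Theory.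
Import numFieldNormedType.Exports.

Local Open Scope classical_set_scope.
Local Open Scope ring_scope.
Local Open Scope complex_scope.

(** * Moduli and polynomial estimates *)

Section Modulus.
Variable R : realType.
Implicit Types x y z : R[i].

(* The norm of [R[i]] has its values in [R[i]], whose order is partial. *)
Definition cmod z : R := complex.Re `|z|.

Lemma cmodE z : `|z| = (cmod z)%:C.
Proof. by rewrite /cmod normc_def. Qed.

Lemma cmod_ge0 z : 0 <= cmod z.
Proof. by rewrite -lecR -cmodE normr_ge0. Qed.

Lemma cmod_realC (a : R) : cmod a%:C = `|a|.
Proof. by rewrite /cmod normc_def /= expr0n addr0 sqrtr_sqr. Qed.

Lemma cmodM x y : cmod (x * y) = cmod x * cmod y.
Proof. by apply: complexI; rewrite rmorphM -!cmodE normrM. Qed.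

Lemma cmodD x y : cmod (x + y) <= cmod x + cmod y.
Proof. by rewrite -lecR rmorphD -!cmodE ler_normD. Qed.

Lemma cmodN x : cmod (- x) = cmod x.
Proof. by rewrite /cmod normrN. Qed.

Lemma cmod0 : cmod 0 = 0.
Proof. by rewrite /cmod normr0. Qed.

Lemma cmod1 : cmod 1 = 1.
Proof. by rewrite /cmod normr1. Qed.

Lemma cmodX x n : cmod (x ^+ n) = cmod x ^+ n.
Proof. by elim: n => [|n IH]; rewrite ?expr0 ?cmod1 // !exprS cmodM IH. Qed.

Lemma cmodV x : cmod x^-1 = (cmod x)^-1.
Proof. by apply: complexI; rewrite fmorphV -!cmodE normfV. Qed.

Lemma cmod_eq0 x : (cmod x == 0) = (x == 0).
Proof. by rewrite -[RHS]normr_eq0 cmodE -(inj_eq (@complexI R)). Qed.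

Lemma cmod_gt0 x : (0 < cmod x) = (x != 0).
Proof. by rewrite lt_def cmod_ge0 andbT cmod_eq0. Qed.

Lemma cmodB x y : cmod (x - y) = cmod (y - x).
Proof. by rewrite -cmodN opprB. Qed.

Lemma cmodBD x y : cmod (x - y) <= cmod x + cmod y.
Proof. by rewrite -(cmodN y) cmodD. Qed.

Lemma cmod_lD x y : cmod x - cmod y <= cmod (x + y).
Proof. by have := cmodBD (x + y) y; rewrite addrK; lra. Qed.

Lemma cmod_lB x y : cmod x - cmod y <= cmod (x - y).
Proof. by rewrite -(cmodN y) cmod_lD. Qed.

Lemma cmod_tri x y z : cmod (x - z) <= cmod (x - y) + cmod (y - z).
Proof. by rewrite -[x - z](_ : (x - y) + (y - z) = _) ?cmodD //; ring. Qed.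

Lemma cmod_sum (I : Type) (r : seq I) (P : pred I) (F : I -> R[i]) :
  cmod (\sum_(i <- r | P i) F i) <= \sum_(i <- r | P i) cmod (F i).
Proof.
elim/big_ind2: _ => [|a b c d H1 H2|//]; first by rewrite cmod0.
by rewrite (le_trans (cmodD _ _)) // lerD.
Qed.

Lemma cmod_nat n : cmod (n%:R : R[i]) = n%:R.
Proof. by rewrite -[n%:R](rmorph_nat (real_complex R)) cmod_realC ger0_norm. Qed.

End Modulus.

(** * Small roots of polynomials and Cauchy's estimate on the unit disc *)

Section PolyBounds.
Variable R : realType.
Local Notation C := R[i].
Implicit Types (p q : {poly C}) (x y z : C).

Lemma exists_min_cmod (s : seq C) : s != [::] ->
  exists2 z, z \in s & forall w, w \in s -> cmod z <= cmod w.
Proof.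
elim: s => // a [|b s] IH _.
  by exists a; rewrite ?mem_seq1 // => w; rewrite mem_seq1 => /eqP->.
have [z zs zm] := IH isT; have [az|za] := leP (cmod a) (cmod z).
  exists a; rewrite ?inE ?eqxx // => w; rewrite inE => /orP[/eqP->//|ws].
  exact: le_trans az (zm w ws).
exists z; first by rewrite inE zs orbT.
by move=> w; rewrite inE => /orP[/eqP->|/zm//]; exact: ltW.
Qed.

(** Up to sign the ratio of the two coefficients is the sum of the reciprocals of the roots, each of
    modulus at most [1 / r]. With denominators cleared, the induction does not have to exclude the
    root 0. *)
Lemma prod_roots_coef1_le (s : seq C) (r : R) : 0 <= r ->
  (forall z, z \in s -> r <= cmod z) ->
  r * cmod (\prod_(z <- s) ('X - z%:P))`_1 <=
    (size s)%:R * cmod (\prod_(z <- s) ('X - z%:P))`_0.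
Proof.
move=> r0; elim: s => [|a s IH] H.
  by rewrite !big_nil !coef1 /= cmod0 mulr0 mul0r.
rewrite !big_cons !mulrBl !coefB !coefXM !coefCM /= sub0r cmodN cmodM.
have ra : r <= cmod a by apply: H; rewrite inE eqxx.
have /IH : forall z, z \in s -> r <= cmod z.
  by move=> z zs; apply: H; rewrite inE zs orbT.
set P := \prod_(z <- s) ('X - z%:P); set P1 := P`_1; set P0 := P`_0 => HI.
have := cmodBD P0 (a * P1); rewrite cmodM => H1.
rewrite -natr1; move: HI H1.
move: (cmod P0) (cmod P1) (cmod_ge0 P0) (cmod_ge0 P1) (size s)%:R => u v u0 v0 n.
move: (cmod a) ra (cmod (P0 - a * P1)) => c rc w H1 H2.
have H3 : r * w <= r * (u + c * v) by rewrite ler_wpM2l.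
have H4 : c * (r * v) <= c * (n * u) by rewrite ler_wpM2l //; lra.
have H5 : r * u <= c * u by rewrite ler_wpM2r.
by apply: (le_trans H3); nra.
Qed.

(** The root of least modulus satisfies the bound: its modulus serves as [r] in
    [prod_roots_coef1_le]. *)
Lemma small_root p : p`_1 != 0 ->
  exists2 x, root p x & cmod x * cmod p`_1 <= (size p)%:R * cmod p`_0.
Proof.
move=> p1; have [s ps] := closed_field_poly_normal p.
have p0 : p != 0 by apply: contra_neq p1 => ->; rewrite coef0.
have l0 : lead_coef p != 0 by rewrite lead_coef_eq0.
have s0 : s != [::].
  apply: contra_neq p1 => s0; rewrite ps s0 big_nil coefZ coef1 /=.
  by rewrite mulr0.
have sz : size p = (size s).+1 by rewrite ps size_scale // size_prod_XsubC.
have [z zs zm] := exists_min_cmod s0; exists z.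
  by rewrite ps rootZ // root_prod_XsubC.
have := prod_roots_coef1_le (cmod_ge0 z) zm.
set P := \prod_(z <- s) ('X - z%:P) => H.
have pE i : p`_i = lead_coef p * P`_i by rewrite {1}ps coefZ.
rewrite sz !pE !cmodM; move: H; set u := cmod P`_1; set v := cmod P`_0 => H.
have lp : 0 < cmod (lead_coef p) by rewrite cmod_gt0.
rewrite mulrCA [leRHS]mulrCA ler_pM2l //; apply: (le_trans H).
by rewrite ler_wpM2r ?cmod_ge0 // ler_nat.
Qed.

Lemma cmodX_sub_le x y (r : R) k : cmod x <= r -> cmod y <= r ->
  cmod (x ^+ k.+1 - y ^+ k.+1) <= k.+1%:R * r ^+ k * cmod (x - y).
Proof.
move=> xr yr; have r0 : 0 <= r := le_trans (cmod_ge0 _) xr.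
rewrite subrXX cmodM mulrC ler_wpM2r ?cmod_ge0 //.
apply: le_trans (cmod_sum _ _ _) _.
rewrite mulr_natl -[X in _ *+ X]card_ord -sumr_const.
apply: ler_sum => i _; rewrite cmodM !cmodX /=.
have -> : r ^+ k = r ^+ (k - i) * r ^+ i by rewrite -exprD subnK // -ltnS.
by rewrite ler_pM ?exprn_ge0 ?cmod_ge0 // lerXn2r // ?nnegrE ?cmod_ge0 // ?subSS.
Qed.

(** On the disc of radius [r] the terms of degree at least 2 have a Lipschitz constant of order [r].
    This drives the size estimate of [newton_root] and the contraction in [lift_step]. *)
Lemma poly_quad p n (B r : R) x y : (size p <= n)%N -> r <= 1 ->
  (forall k, (2 <= k)%N -> cmod p`_k <= B) -> cmod x <= r -> cmod y <= r ->
  cmod (p.[x] - p.[y] - p`_1 * (x - y)) <= n%:R * n%:R * B * r * cmod (x - y).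
Proof.
move=> sn r1 HB xr yr; have r0 : 0 <= r := le_trans (cmod_ge0 _) xr.
have B0 : 0 <= B := le_trans (cmod_ge0 _) (HB 2%N isT).
pose q := p - p`_1 *: 'X.
have -> : p.[x] - p.[y] - p`_1 * (x - y) = q.[x] - q.[y].
  by rewrite /q !hornerE; ring.
have sq : (size q <= n.+2)%N.
  apply: (leq_trans (size_polyD _ _)); rewrite size_polyN geq_max; apply/andP; split.
    by apply: (leq_trans sn); rewrite !leqW.
  by apply: (leq_trans (size_scale_leq _ _)); rewrite size_polyX.
have Hk k : cmod (q`_k * (x ^+ k - y ^+ k)) <=
    (if (k < n)%N then n%:R * B * r * cmod (x - y) else 0).
  case: k => [|[|k]].
  - by rewrite !expr0 subrr mulr0 cmod0; case: ifP => // _; rewrite !mulr_ge0 ?cmod_ge0.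
  - rewrite /q coefB coefZ coefX mulr1 subrr mul0r cmod0.
    by case: ifP => // _; rewrite !mulr_ge0 ?cmod_ge0.
  - have qk : q`_k.+2 = p`_k.+2 by rewrite /q coefB coefZ coefX /= mulr0 subr0.
    rewrite qk; case: ifP => [kn|/negbT]; last first.
      rewrite -leqNgt => nk; rewrite nth_default ?(leq_trans sn) //.
      by rewrite mul0r cmod0.
    rewrite cmodM; have := @cmodX_sub_le x y r k.+1 xr yr => H.
    have Hr : r ^+ k.+1 <= r.
      by rewrite exprS ler_piMr // exprn_ile1.
    have Hn : (k.+2%:R : R) <= n%:R by rewrite ler_nat ltnW.
    have H2 : k.+2%:R * r ^+ k.+1 <= n%:R * r by rewrite ler_pM ?exprn_ge0.
    apply: (le_trans (ler_pM (cmod_ge0 _) (cmod_ge0 _) (HB k.+2 isT) H)).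
    rewrite [n%:R * B]mulrC -!mulrA ler_wpM2l // !mulrA ler_wpM2r ?cmod_ge0 //.
rewrite (horner_coef_wide x sq) (horner_coef_wide y sq) -sumrB.
under eq_bigr => i _ do rewrite -mulrBr.
apply: le_trans (cmod_sum _ _ _) _.
apply: (@le_trans _ _ (\sum_(k < n.+2) if (k < n)%N then n%:R * B * r * cmod (x - y) else 0)).
  by apply: ler_sum => i _; exact: Hk.
rewrite -(big_mkord xpredT (fun k => if (k < n)%N then _ else _)) /=.
rewrite -big_mkcond /=.
have -> : \sum_(0 <= i < n.+2 | (i < n)%N) (n%:R * B * r * cmod (x - y)) =
   \sum_(0 <= i < n) (n%:R * B * r * cmod (x - y)).
  by rewrite [RHS](big_nat_widen _ _ n.+2) //= leqW.
by rewrite big_mkord sumr_const card_ord -[leLHS]mulr_natl !mulrA.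
Qed.

(** At a root that [small_root] shows to be small, the nonlinear terms are at most half of the
    linear one, which improves the factor [size p] to 2. The threshold [d] depends only on [n], [k]
    and [B], so it serves a whole family of polynomials. *)
Lemma newton_root n (k B : R) : 0 < k -> 0 <= B ->
  exists2 d : R, 0 < d & forall p, (size p <= n)%N -> k <= cmod p`_1 ->
    (forall j, (2 <= j)%N -> cmod p`_j <= B) -> cmod p`_0 <= d ->
    exists2 x, root p x & cmod x * k <= 2 * cmod p`_0.
Proof.
move=> k0 B0; pose m : R := n.+1%:R; have m1 : 1 <= m by rewrite ler1n.
have m0 : 0 < m by rewrite ltr0n.
have A0 : 0 < 2 * m * m * (B + 1) by rewrite !mulr_gt0 // ltr_wpDl.
(* Within radius [e] the constant of [poly_quad] is at most [k / 2]; the division by [m] below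
   absorbs the factor [size p] of [small_root]. *)
pose e := Num.min 1 (k / (2 * m * m * (B + 1))).
have e0 : 0 < e by rewrite lt_min ltr01 /= divr_gt0.
exists (k * e / m); first by rewrite divr_gt0 // mulr_gt0.
move=> p sp kp Hp p0.
have p1 : p`_1 != 0 by rewrite -cmod_gt0 (lt_le_trans k0).
have [x rx Hx] := small_root p1; exists x => //.
have xe : cmod x <= e.
  have H1 : cmod x * k <= k * e.
    apply: (le_trans (ler_wpM2l (cmod_ge0 _) kp)); apply: (le_trans Hx).
    apply: (@le_trans _ _ (m * (k * e / m))); last by rewrite mulrC divfK // gt_eqF.
    by rewrite ler_pM ?cmod_ge0 // ler_nat leqW.
  by rewrite -(ler_pM2l k0) mulrC.
have x1 : cmod x <= 1 by rewrite (le_trans xe) // ge_min lexx.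
have := @poly_quad p n B (cmod x) x 0 sp x1 Hp (lexx _).
rewrite cmod0 => /(_ (cmod_ge0 _)).
rewrite horner_coef0 subr0 (rootP rx) sub0r => H.
have H1 := cmod_lB (- (p`_1 * x)) (p`_0).
have H2 : cmod (- (p`_1 * x) - p`_0) = cmod (- p`_0 - p`_1 * x).
  by congr cmod; ring.
rewrite H2 in H1; rewrite cmodN cmodM in H1.
have H3 : k * cmod x <= cmod p`_1 * cmod x by rewrite ler_wpM2r ?cmod_ge0.
have H4 : n%:R * n%:R * B * cmod x <= k / 2.
  apply: (@le_trans _ _ (m * m * (B + 1) * (k / (2 * m * m * (B + 1))))); last first.
    rewrite le_eqVlt; apply/orP; left; apply/eqP; field.
    by rewrite -/m !gt_eqF // ltr_wpDl.
  rewrite ler_pM ?cmod_ge0 ?mulr_ge0 //.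
    rewrite ler_pM ?mulr_ge0 //; last by rewrite lerDl.
    by rewrite ler_pM // ler_nat.
  by rewrite (le_trans xe) // ge_min lexx orbT.
have H5 : n%:R * n%:R * B * cmod x * cmod x <= k / 2 * cmod x.
  by rewrite ler_wpM2r ?cmod_ge0.
by lra.
Qed.

Lemma poly_bound p (M : R) :
  exists2 B : R, 0 < B & forall x, cmod x <= M -> cmod p.[x] <= B.
Proof.
elim/poly_ind: p => [|p c [B B0 IH]].
  by exists 1 => // x _; rewrite horner0 cmod0.
exists (B * (`|M| + 1) + cmod c).
  by rewrite ltr_wpDr ?cmod_ge0 // mulr_gt0 // ltr_wpDl.
move=> x xM; rewrite !hornerE (le_trans (cmodD _ _)) // lerD2r cmodM.
rewrite ler_pM ?cmod_ge0 ?IH // (le_trans xM) // (le_trans (ler_norm _)) // lerDl //.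
Qed.

Lemma poly_lip p (M : R) : exists2 L : R, 0 < L &
  forall x y, cmod x <= M -> cmod y <= M ->
    cmod (p.[x] - p.[y]) <= L * cmod (x - y).
Proof.
elim/poly_ind: p => [|p c [L L0 IH]].
  by exists 1 => // x y _ _; rewrite !horner0 subrr cmod0 mul1r cmod_ge0.
have [B B0 HB] := poly_bound p M.
exists (L * (`|M| + 1) + B).
  by rewrite ltr_wpDr ?ltW // mulr_gt0 // ltr_wpDl.
move=> x y xM yM; rewrite !hornerE.
have -> : p.[x] * x + c - (p.[y] * y + c) = (p.[x] - p.[y]) * x + p.[y] * (x - y).
  by ring.
rewrite (le_trans (cmodD _ _)) // !cmodM mulrDl lerD //; last first.
  by rewrite ler_wpM2r ?cmod_ge0 ?HB.
rewrite mulrAC ler_pM ?cmod_ge0 ?IH // (le_trans xM) // (le_trans (ler_norm _)) // lerDl //.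
Qed.

Lemma primitive_root_exists n : (0 < n)%N -> exists w : C, n.-primitive_root w.
Proof.
move=> n0; pose p : {poly C} := 'X^n - 1.
have [r Dp] := closed_field_poly_normal p; move: Dp.
rewrite lead_coefXnsubC // scale1r => Dp.
have rn1 : all n.-unity_root r by apply/allP => z; rewrite -root_prod_XsubC -Dp.
have sr : (n < (size r).+1)%N by rewrite -(size_prod_XsubC r id) -Dp size_XnsubC.
have [|z] := hasP (has_prim_root n0 rn1 _ sr); last by exists z.
by rewrite -separable_prod_XsubC -Dp separable_Xn_sub_1 // pnatr_eq0 -lt0n.
Qed.

Lemma cmod_unity_root z n : z ^+ n.+1 = 1 -> cmod z = 1.
Proof.
move=> zn; apply/eqP; rewrite -(@pexpr_eq1 _ _ n.+1) ?cmod_ge0 //.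
by rewrite -cmodX zn cmod1.
Qed.

Lemma sum_unity_root z n : z ^+ n = 1 -> z != 1 -> \sum_(k < n) z ^+ k = 0.
Proof.
move=> zn z1; apply/eqP; have := subrX1 z n; rewrite zn subrr => /esym/eqP.
by rewrite mulf_eq0 subr_eq0 (negPf z1).
Qed.

(* Averaging [p (w ^ k) / w ^ k] over a primitive root of unity [w] of large
   order isolates the coefficient of degree one. *)
Lemma cauchy_poly p (M : R) :
  (forall t, cmod t <= 1 -> cmod p.[t] <= M) -> cmod p`_1 <= M.
Proof.
move=> HM; pose n := (size p).+1; have n0 : (0 < n.+1)%N by [].
have [w wP] := primitive_root_exists n0.
have wn : w ^+ n.+1 = 1 by rewrite prim_expr_order.
have wm : cmod w = 1 := cmod_unity_root wn.
(* As [w] has order [n.+1], multiplying by [w ^+ (k * n)] divides by [w ^+ k]; among the exponents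
   [i < n] only [i = 1] survives. *)
have E : \sum_(k < n.+1) p.[w ^+ k] * w ^+ (k * n) = n.+1%:R * p`_1.
  transitivity (\sum_(k < n.+1) \sum_(i < n) p`_i * (w ^+ (i + n)) ^+ k).
    apply: eq_bigr => k _; rewrite (horner_coef_wide _ (leqnSn _)) mulr_suml.
    apply: eq_bigr => i _; rewrite -mulrA -!exprM -exprD; congr (_ * w ^+ _).
    by rewrite mulnDl mulnC [(k * n)%N]mulnC.
  rewrite exchange_big /=.
  under eq_bigr => i _ do rewrite -mulr_sumr.
  have [s1|s1] := leqP (size p) 0.
    move: s1; rewrite leqn0 size_poly_eq0 => /eqP->; rewrite coef0 mulr0.
    by rewrite big1 // => i _; rewrite coef0 mul0r.
  have n1 : (1 < n)%N by [].
  rewrite (bigD1 (Ordinal n1)) //= add1n wn.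
  under eq_bigr => k _ do rewrite expr1n.
  rewrite sumr_const card_ord big1 ?addr0 ?mulr_natl ?mulr_natr // => i i1.
  rewrite sum_unity_root ?mulr0 //; first by rewrite exprAC wn expr1n.
  rewrite -(prim_order_dvd wP); apply: contra i1 => dv; apply/eqP/val_inj => /=.
  have iltn := ltn_ord i.
  case: (val i) iltn dv => [|[|j]] //= jn.
    by rewrite add0n gtnNdvd.
  rewrite addSnnS dvdn_addl // gtnNdvd //.
  by rewrite !ltnS ltnW // ltnW.
have Hs : cmod (\sum_(k < n.+1) p.[w ^+ k] * w ^+ (k * n)) <= n.+1%:R * M.
  apply: le_trans (cmod_sum _ _ _) _.
  rewrite mulr_natl -[X in _ *+ X]card_ord -sumr_const.
  apply: ler_sum => k _; rewrite cmodM !cmodX wm !expr1n mulr1 HM //.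
  by rewrite cmodX wm expr1n.
by move: Hs; rewrite E cmodM cmod_nat ler_pM2l.
Qed.

End PolyBounds.

(** * Discs as uniform limits of polynomials *)

Section DiscApproximation.
Variable R : realType.
Local Notation C := R[i].
Implicit Types (p q P Q : {poly C}) (x y z t : C) (phi psi : C -> C).

Lemma exprn_le_eps (b e : R) : 0 <= b < 1 -> 0 < e -> exists n, b ^+ n <= e.
Proof.
move=> /andP[b0 b1] e0.
have nb : `|b| < 1 by rewrite ger0_norm.
have /cvgrPdist_le /(_ e e0) [n _ Hn] := cvg_expr nb.
exists n; have := Hn n (leqnn n).
by rewrite sub0r normrN ger0_norm // exprn_ge0.
Qed.

(** These functions form the disc algebra: continuous on the closed disc and holomorphic inside.
    Values off the closed disc are irrelevant. *)
Definition disc_approx phi := forall e : R, 0 < e ->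
  exists P, forall t, cmod t <= 1 -> cmod (P.[t] - phi t) <= e.

Lemma disc_approx_poly P : disc_approx (fun t => P.[t]).
Proof. by move=> e e0; exists P => t _; rewrite subrr cmod0 ltW. Qed.

Lemma disc_approx_cst z : disc_approx (fun=> z).
Proof. by move=> e e0; exists z%:P => t _; rewrite hornerC subrr cmod0 ltW. Qed.

Lemma disc_approx_limit phi :
  (forall e : R, 0 < e -> exists psi, disc_approx psi /\
     forall t, cmod t <= 1 -> cmod (psi t - phi t) <= e) -> disc_approx phi.
Proof.
move=> H e e0; have e2 : 0 < e / 2 by rewrite divr_gt0.
have [psi [Hpsi Hd]] := H _ e2; have [P HP] := Hpsi _ e2.
exists P => t t1; have := cmod_tri P.[t] (psi t) (phi t).
by have := HP t t1; have := Hd t t1; lra.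
Qed.

Lemma disc_approx_ext phi psi : (forall t, cmod t <= 1 -> phi t = psi t) ->
  disc_approx phi -> disc_approx psi.
Proof.
move=> E H; apply: disc_approx_limit => e e0; exists phi; split=> // t t1.
by rewrite E // subrr cmod0 ltW.
Qed.

Lemma disc_approx_bound phi : disc_approx phi ->
  exists2 B : R, 0 < B & forall t, cmod t <= 1 -> cmod (phi t) <= B.
Proof.
move=> /(_ 1 ltr01) [P HP]; have [B B0 HB] := poly_bound P 1.
exists (B + 1) => [|t t1]; first by rewrite ltr_wpDl // ltW.
have := HP t t1; have := HB t t1; have := cmodBD P.[t] (P.[t] - phi t).
by rewrite opprB addrC subrK; lra.
Qed.

Lemma disc_approxD phi psi : disc_approx phi -> disc_approx psi ->
  disc_approx (fun t => phi t + psi t).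
Proof.
move=> H1 H2 e e0; have e2 : 0 < e / 2 by rewrite divr_gt0.
have [P HP] := H1 _ e2; have [Q HQ] := H2 _ e2; exists (P + Q) => t t1.
have := HP t t1; have := HQ t t1.
have := cmodD (P.[t] - phi t) (Q.[t] - psi t).
have -> : P.[t] - phi t + (Q.[t] - psi t) = (P + Q).[t] - (phi t + psi t).
  by rewrite hornerD; ring.
by lra.
Qed.

Lemma disc_approxM phi psi : disc_approx phi -> disc_approx psi ->
  disc_approx (fun t => phi t * psi t).
Proof.
move=> H1 H2; have [B B0 HB] := disc_approx_bound H1.
have [B' B'0 HB'] := disc_approx_bound H2.
move=> e e0; have K0 : 0 < B + B' + 1 by rewrite addr_gt0 // addr_gt0.
pose d := Num.min 1 (e / (B + B' + 1)).
have d0 : 0 < d by rewrite lt_min ltr01 divr_gt0.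
have d1 : d <= 1 by rewrite ge_min lexx.
have de : d * (B + B' + 1) <= e by rewrite -ler_pdivlMr // ge_min lexx orbT.
have [P HP] := H1 _ d0; have [Q HQ] := H2 _ d0; exists (P * Q) => t t1.
rewrite hornerM.
have -> : P.[t] * Q.[t] - phi t * psi t =
  (P.[t] - phi t) * (Q.[t] - psi t) + (P.[t] - phi t) * psi t
  + phi t * (Q.[t] - psi t) by ring.
have := cmodD ((P.[t] - phi t) * (Q.[t] - psi t) + (P.[t] - phi t) * psi t)
  (phi t * (Q.[t] - psi t)).
have := cmodD ((P.[t] - phi t) * (Q.[t] - psi t)) ((P.[t] - phi t) * psi t).
rewrite !cmodM.
have := HP t t1; have := HQ t t1; have := HB t t1; have := HB' t t1.
move: (cmod_ge0 (P.[t] - phi t)) (cmod_ge0 (Q.[t] - psi t)).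
move: (cmod_ge0 (phi t)) (cmod_ge0 (psi t)).
move: (cmod (P.[t] - phi t)) (cmod (Q.[t] - psi t)) (cmod (phi t)) (cmod (psi t)).
move=> a b u v u0 v0 a0 b0 vB uB bd ad.
have h1 : a * b <= d * 1 by rewrite ler_pM // (le_trans bd).
have h2 : a * v <= d * B' by rewrite ler_pM.
have h3 : u * b <= B * d by rewrite ler_pM.
by nra.
Qed.

Lemma disc_approxB phi psi : disc_approx phi -> disc_approx psi ->
  disc_approx (fun t => phi t - psi t).
Proof.
move=> H1 H2; apply: (@disc_approx_ext (fun t => phi t + (-1) * psi t)) => [t _|].
  by rewrite mulN1r.
by apply: disc_approxD => //; apply: disc_approxM => //; exact: disc_approx_cst.
Qed.

Lemma disc_approx_horner p phi : disc_approx phi ->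
  disc_approx (fun t => p.[phi t]).
Proof.
move=> H; elim/poly_ind: p => [|p c IH].
  by apply: (disc_approx_ext _ (disc_approx_cst 0)) => t _; rewrite horner0.
apply: (@disc_approx_ext (fun t => p.[phi t] * phi t + c)) => [t _|].
  by rewrite !hornerE.
by apply: disc_approxD; [exact: disc_approxM|exact: disc_approx_cst].
Qed.

(** Truncated geometric series in [t / a], whose ratio is at most [1 / |a| < 1] on the disc. *)
Lemma disc_approx_invXsubC a : 1 < cmod a -> disc_approx (fun t => (t - a)^-1).
Proof.
move=> a1 e e0; have a0 : a != 0 by rewrite -cmod_gt0 (lt_trans ltr01).
have ca0 : 0 < cmod a by rewrite cmod_gt0.
have b01 : 0 <= (cmod a)^-1 < 1 by rewrite invr_ge0 ltW //= invf_lt1.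
have ea : 0 < e * (cmod a - 1) by rewrite mulr_gt0 // subr_gt0.
have [n Hn] := exprn_le_eps b01 ea.
exists (- a^-1 *: \sum_(k < n) (a^-1 *: 'X) ^+ k) => t t1.
have ta : t - a != 0.
  by rewrite subr_eq0; apply: contraTneq t1 => ->; rewrite -ltNge.
have -> : (- a^-1 *: \sum_(k < n) (a^-1 *: 'X) ^+ k).[t] - (t - a)^-1 =
  - (a^-1 * t) ^+ n * (t - a)^-1.
  rewrite hornerZ horner_sum.
  under eq_bigr => k _ do rewrite horner_exp hornerZ hornerX.
  have := subrX1 (a^-1 * t) n; set S := \sum_(k < n) _ => E.
  apply: (mulIf ta); rewrite mulrBl mulrVK ?unitfE // mulVf //.
  rewrite (_ : - a^-1 * S * (t - a) = - ((a^-1 * t - 1) * S)); last by field.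
  by rewrite -E; ring.
rewrite cmodM cmodN cmodX !cmodM !cmodV.
have H1 : cmod a - 1 <= cmod (t - a) by have := cmod_lB a t; rewrite cmodB; lra.
have H0 : 0 < cmod a - 1 by lra.
rewrite ler_pdivrMr ?(lt_le_trans H0) //.
apply: (@le_trans _ _ ((cmod a)^-1 ^+ n)).
  by rewrite lerXn2r ?nnegrE ?mulr_ge0 ?invr_ge0 ?cmod_ge0 // ler_piMr // invr_ge0 cmod_ge0.
by apply: (le_trans Hn); rewrite ler_pM2l.
Qed.

(** All roots of [P] lie outside the closed disc, so the inverse is a product of inverses of such
    linear factors. *)
Lemma disc_approx_inv_poly P : (forall t, cmod t <= 1 -> P.[t] != 0) ->
  disc_approx (fun t => P.[t]^-1).
Proof.
have [s Ps] := closed_field_poly_normal P; rewrite Ps => H.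
have {}H : forall a, a \in s -> 1 < cmod a.
  move=> a sa; rewrite ltNge; apply/negP => a1; have := H a a1.
  rewrite -[_ == 0]/(root _ a) => /negP; apply; rewrite rootE hornerZ mulf_eq0.
  by apply/orP; right; rewrite -[_ == 0]/(root _ a) root_prod_XsubC.
apply: (@disc_approx_ext (fun t => (lead_coef P)^-1 *
  (\prod_(z <- s) ('X - z%:P)).[t]^-1)) => [t _|].
  by rewrite hornerZ invfM.
apply: disc_approxM; first exact: disc_approx_cst.
elim: s H {Ps} => [_|a s IH H].
  by apply: (disc_approx_ext _ (disc_approx_cst 1)) => t _; rewrite big_nil hornerC invr1.
apply: (@disc_approx_ext (fun t => (t - a)^-1 *
  (\prod_(z <- s) ('X - z%:P)).[t]^-1)) => [t _|].
  by rewrite big_cons hornerM hornerXsubC invfM.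
apply: disc_approxM.
  by apply: disc_approx_invXsubC; apply: H; rewrite inE eqxx.
by apply: IH => b sb; apply: H; rewrite inE sb orbT.
Qed.

(** A close polynomial approximation keeps modulus at least [k / 2], hence can be inverted, and
    inversion is Lipschitz away from 0. *)
Lemma disc_approxV phi (k : R) : 0 < k ->
  (forall t, cmod t <= 1 -> k <= cmod (phi t)) ->
  disc_approx phi -> disc_approx (fun t => (phi t)^-1).
Proof.
move=> k0 Hk H; apply: disc_approx_limit => e e0.
pose d := Num.min (k / 2) (e * (k / 2 * k)).
have k2 : 0 < k / 2 by rewrite divr_gt0.
have d0 : 0 < d by rewrite lt_min k2 mulr_gt0 // mulr_gt0.
have dk : d <= k / 2 by rewrite ge_min lexx.
have de : d <= e * (k / 2 * k) by rewrite ge_min lexx orbT.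
have [P HP] := H _ d0.
have Pk t : cmod t <= 1 -> k / 2 <= cmod P.[t].
  move=> t1; have := HP t t1; have := Hk t t1.
  by have := cmod_lB (phi t) P.[t]; rewrite cmodB; lra.
exists (fun t => P.[t]^-1); split.
  apply: disc_approx_inv_poly => t t1.
  by rewrite -cmod_gt0 (lt_le_trans k2) // Pk.
move=> t t1; have P0 : P.[t] != 0 by rewrite -cmod_gt0 (lt_le_trans k2) // Pk.
have f0 : phi t != 0 by rewrite -cmod_gt0 (lt_le_trans k0) // Hk.
have -> : P.[t]^-1 - (phi t)^-1 = (phi t - P.[t]) / (P.[t] * phi t).
  by field; rewrite f0 P0.
have H0 : k / 2 * k <= cmod (P.[t] * phi t).
  by rewrite cmodM ler_pM ?Pk ?Hk // ltW.
have H1 : 0 < k / 2 * k by rewrite mulr_gt0.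
rewrite cmodM cmodV cmodB ler_pdivrMr ?(lt_le_trans H1) //.
apply: (le_trans (HP t t1)); apply: (le_trans de).
by rewrite ler_pM2l.
Qed.

(** Divided by the square of [|Q.[0]|], this is Cauchy's estimate at 0 for [P / Q]. A polynomial [U]
    approximates the quotient, and [cauchy_poly] bounds the linear coefficients of [U] and of the
    error [U * Q - P]. *)
Lemma cauchy_quotient P Q (M : R) : 0 <= M ->
  (forall t, cmod t <= 1 -> Q.[t] != 0 /\ cmod P.[t] <= M * cmod Q.[t]) ->
  cmod (P`_1 * Q`_0 - P`_0 * Q`_1) <= M * cmod Q`_0 ^+ 2.
Proof.
move=> M0 H.
have Hinv : disc_approx (fun t => Q.[t]^-1).
  by apply: disc_approx_inv_poly => t t1; case: (H t t1).
have H2 : disc_approx (fun t => P.[t] / Q.[t]).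
  by apply: disc_approxM => //; exact: disc_approx_poly.
have [B B0 HB] := poly_bound Q 1.
have main (e : R) : 0 < e -> cmod (P`_1 * Q`_0 - P`_0 * Q`_1) <=
    (M + e) * cmod Q`_0 ^+ 2 + (B * e * cmod Q`_0 + e * cmod Q`_0 * cmod Q`_1).
  move=> e0; have [U HU] := H2 _ e0.
  have U1 : cmod U`_1 <= M + e.
    apply: cauchy_poly => t t1; have [Q0 PQ] := H t t1.
    have := HU t t1; have := cmodD (U.[t] - P.[t] / Q.[t]) (P.[t] / Q.[t]).
    rewrite subrK; suff : cmod (P.[t] / Q.[t]) <= M by lra.
    by rewrite cmodM cmodV ler_pdivrMr ?cmod_gt0.
  have E1 : cmod (U * Q - P)`_1 <= B * e.
    apply: cauchy_poly => t t1; have [Q0 PQ] := H t t1.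
    rewrite hornerD hornerN hornerM.
    have -> : U.[t] * Q.[t] - P.[t] = (U.[t] - P.[t] / Q.[t]) * Q.[t].
      by rewrite mulrBl mulrVK ?unitfE.
    by rewrite cmodM mulrC ler_pM ?cmod_ge0 // ?HB // HU.
  have E0 : cmod (U`_0 * Q`_0 - P`_0) <= e * cmod Q`_0.
    have h0 : cmod (0 : C) <= 1 by rewrite cmod0.
    have [] := H 0 h0; rewrite -!horner_coef0 => Q0 _.
    have -> : U.[0] * Q.[0] - P.[0] = (U.[0] - P.[0] / Q.[0]) * Q.[0].
      by rewrite mulrBl mulrVK ?unitfE.
    by rewrite cmodM ler_wpM2r ?cmod_ge0 // HU.
  have D1 : (U * Q - P)`_1 = U`_1 * Q`_0 + U`_0 * Q`_1 - P`_1.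
    by rewrite coefB coefM !big_ord_recl big_ord0 /=; ring.
  have -> : P`_1 * Q`_0 - P`_0 * Q`_1 = U`_1 * Q`_0 ^+ 2 +
     (- (U * Q - P)`_1 * Q`_0 + (U`_0 * Q`_0 - P`_0) * Q`_1).
    by rewrite D1; ring.
  apply: (le_trans (cmodD _ _)); apply: lerD.
    by rewrite cmodM cmodX ler_wpM2r ?exprn_ge0 ?cmod_ge0.
  apply: (le_trans (cmodD _ _)); rewrite !cmodM cmodN; apply: lerD.
    by rewrite ler_wpM2r ?cmod_ge0.
  by rewrite ler_wpM2r ?cmod_ge0.
apply/ler_addgt0Pr => e e0.
pose K := cmod Q`_0 ^+ 2 + B * cmod Q`_0 + cmod Q`_0 * cmod Q`_1 + 1.
have K0 : 0 < K.
  by rewrite ltr_wpDl // !addr_ge0 ?exprn_ge0 ?mulr_ge0 ?cmod_ge0 // ltW.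
have eK : 0 < e / K by rewrite divr_gt0.
have Ke : e / K * K = e by rewrite divfK // gt_eqF.
apply: (le_trans (main _ eK)); rewrite -[X in _ <= _ + X]Ke /K.
have := cmod_ge0 Q`_0; have := cmod_ge0 Q`_1.
by move: (e / _) eK => d d0 _ _; nra.
Qed.

End DiscApproximation.

(** * Lifting discs through a rational map *)

Section Lifting.
Variable R : realType.
Local Notation C := R[i].
Implicit Types (P Q : {poly C}) (x y z t : C) (phi psi : C -> C).
(** The equation [p.[x] = y * q.[x]] says, where [q.[x]] is nonzero, that [p / q] sends [x] to [y].
    There [p' - y q'] is [q] times the derivative of [p / q], so [Dk] keeps the preimages of [D]
    away from critical points. *)
Variables (p q : {poly C}) (D : C -> Prop) (M k : R).
Hypothesis k0 : 0 < k.
Hypothesis DM : forall y, D y -> cmod y <= M.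
Hypothesis DpreM : forall x y, D y -> p.[x] = y * q.[x] -> cmod x <= M.
Hypothesis Dk : forall x y, D y -> p.[x] = y * q.[x] ->
  k <= cmod (p^`().[x] - y * q^`().[x]).

Local Notation n := (maxn (size p) (size q)).
Local Notation coefA x y i := (p^`N(i).[x] - y * q^`N(i).[x]).

(** The Taylor expansion of [p - y * q] at [x]: its roots are the displacements from [x] to the
    solutions of [p = y * q]. *)
Definition taylor_residual x y : {poly C} := \poly_(i < n) coefA x y i.
Local Notation A := taylor_residual.

Lemma horner_taylor_residual x y h : (A x y).[h] = p.[x + h] - y * q.[x + h].
Proof.
rewrite horner_poly.
rewrite (nderiv_taylor_wide _ (leq_maxl (size p) (size q))); last exact: mulrC.
rewrite (nderiv_taylor_wide _ (leq_maxr (size p) (size q))); last exact: mulrC.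
rewrite mulr_sumr -sumrB; apply: eq_bigr => i _.
by rewrite mulrBl mulrA.
Qed.

Lemma coef_taylor_residual x y i : (A x y)`_i = coefA x y i.
Proof.
rewrite coef_poly; case: ltnP => // ni.
have H (r : {poly C}) : (size r <= n)%N -> r^`N(i) = 0 :> {poly C}.
  by move=> rn; apply/polyP => j; rewrite coef_nderivn coef0 nth_default ?mul0rn //
    (leq_trans rn) // (leq_trans ni) // leq_addr.
by rewrite !H ?leq_maxl ?leq_maxr // horner0 mulr0 subr0.
Qed.

Lemma coef_taylor_residual_bound : exists2 B : R, 0 < B & forall x y i,
  cmod x <= M -> cmod y <= M -> cmod (coefA x y i) <= B.
Proof.
have [B B0 HB] : exists2 B : R, 0 < B & forall x y i, (i < n)%N ->
    cmod x <= M -> cmod y <= M -> cmod (coefA x y i) <= B.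
  elim: (n) => [|j [B B0 IH]]; first by exists 1.
  have [B1 B10 HB1] := poly_bound p^`N(j) M.
  have [B2 B20 HB2] := poly_bound q^`N(j) M.
  exists (B + B1 + (`|M| + 1) * B2).
    by rewrite !addr_gt0 // mulr_gt0 // ltr_wpDl.
  move=> x y i; rewrite ltnS leq_eqVlt => /orP[/eqP->|ij] xM yM.
    apply: (le_trans (cmodBD _ _)); rewrite cmodM; apply: lerD.
      by rewrite (le_trans (HB1 _ xM)) // lerDr ltW.
    rewrite ler_pM ?cmod_ge0 ?HB2 // (le_trans yM) // (le_trans (ler_norm _)) //.
    by rewrite lerDl.
  apply: (le_trans (IH x y i ij xM yM)); rewrite -addrA lerDl.
  by rewrite addr_ge0 // ?mulr_ge0 ?ltW // ltr_wpDl.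
exists B => // x y i xM yM; have [ni|] := ltnP i n; first exact: HB.
by move=> ni; rewrite -coef_taylor_residual nth_default ?cmod0 ?ltW // (leq_trans (size_poly _ _)).
Qed.

(** A lift of [phi] is almost a lift of a nearby [phi'] and is corrected by a small root of the
    residual. The admissible distance [d] is the same for all discs, so the step can be repeated;
    the last clause fixes the lift wherever the two discs agree, in particular at a common
    centre. *)
Lemma lift_step : exists2 d : R, 0 < d & forall phi phi' psi,
  disc_approx phi' -> disc_approx psi ->
  (forall t, cmod t <= 1 -> [/\ D (phi t), D (phi' t),
     p.[psi t] = phi t * q.[psi t] & cmod (phi t - phi' t) <= d]) ->
  exists2 psi', disc_approx psi' & forall t, cmod t <= 1 ->
     p.[psi' t] = phi' t * q.[psi' t] /\ (phi t = phi' t -> psi' t = psi t).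
Proof.
have [B B0 HB] := coef_taylor_residual_bound.
have k2 : 0 < k / 2 by rewrite divr_gt0.
have [d1 d10 Hd1] := newton_root n k2 (ltW B0).
have [L L0 HL] : exists2 L : R, 0 < L & forall x, cmod x <= M ->
    cmod q.[x] <= L /\ cmod q^`().[x] <= L.
  have [L1 L10 HL1] := poly_bound q M; have [L2 L20 HL2] := poly_bound q^`() M.
  exists (L1 + L2); first by rewrite addr_gt0.
  by move=> x xM; have := HL1 x xM; have := HL2 x xM; split; lra.
(* Within radius [r] the nonlinear part of a residual has Lipschitz constant at most [k / 4], half
   the lower bound [k / 2] of the linear coefficient: Newton's map contracts by 1/2. *)
pose r := Num.min 1 (k / (4 * (n.+1%:R * n.+1%:R * B))).
have N0 : 0 < n.+1%:R * n.+1%:R * B by rewrite !mulr_gt0 ?ltr0n.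
have r0 : 0 < r by rewrite lt_min ltr01 divr_gt0 // mulr_gt0.
have r1 : r <= 1 by rewrite ge_min lexx.
have rk : n%:R * n%:R * B * r <= k / 4.
  apply: (@le_trans _ _ (n.+1%:R * n.+1%:R * B * (k / (4 * (n.+1%:R * n.+1%:R * B))))).
    have rle : r <= k / (4 * (n.+1%:R * n.+1%:R * B)) by rewrite ge_min lexx orbT.
    have nle : (n%:R : R) * n%:R * B <= n.+1%:R * n.+1%:R * B.
      by rewrite ler_pM2r // ler_pM // ler_nat.
    by rewrite ler_pM // ?(ltW r0) // mulr_ge0 ?mulr_ge0 // ltW.
  rewrite le_eqVlt; apply/orP; left; apply/eqP; field.
  by rewrite gt_eqF //= addrC natr1 pnatr_eq0.
(* The three bounds provide a root through [newton_root], keep the linear coefficient above [k / 2]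
   when [phi] becomes [phi'], and place the root within [r / 2]. *)
pose d := Num.min (Num.min (d1 / L) (k / 2 / L)) (r * k / (8 * L)).
have d0 : 0 < d by rewrite !lt_min !divr_gt0 // mulr_gt0.
have dL1 : d * L <= d1 by rewrite -ler_pdivlMr // !ge_min lexx.
have dL2 : d * L <= k / 2 by rewrite -ler_pdivlMr // !ge_min lexx orbT.
have dL3 : d * L <= r * k / 8.
  have : d <= r * k / (8 * L) by rewrite ge_min lexx orbT.
  by rewrite invfM mulrA ler_pdivlMr.
exists d => // phi phi' psi aphi' apsi H.
pose a t := A (psi t) (phi' t).
have psiM t : cmod t <= 1 -> cmod (psi t) <= M.
  by move=> /H[Dp _ E _]; exact: DpreM Dp E.
have phi'M t : cmod t <= 1 -> cmod (phi' t) <= M by move=> /H[_ /DM].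
have sa t : (size (a t) <= n)%N by exact: size_poly.
have a0 t : cmod t <= 1 -> (a t)`_0 = (phi t - phi' t) * q.[psi t].
  move=> /H[_ _ E _]; rewrite -horner_coef0 horner_taylor_residual addr0 E; ring.
have a0d t : cmod t <= 1 -> cmod (a t)`_0 <= d * L.
  move=> t1; rewrite a0 // cmodM; have [_ _ _ Hd] := H t t1.
  by rewrite ler_pM ?cmod_ge0 //; case: (HL _ (psiM t t1)).
have a1E t : (a t)`_1 = p^`().[psi t] - phi' t * q^`().[psi t].
  by rewrite coef_taylor_residual !nderivn1.
have a1 t : cmod t <= 1 -> k / 2 <= cmod (a t)`_1.
  move=> t1; rewrite a1E; have [Dp _ E Hd] := H t t1.
  have := Dk Dp E; have := cmod_lB (p^`().[psi t] - phi t * q^`().[psi t])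
    ((phi' t - phi t) * q^`().[psi t]).
  rewrite (_ : _ - _ - _ = p^`().[psi t] - phi' t * q^`().[psi t]); last by ring.
  have : cmod ((phi' t - phi t) * q^`().[psi t]) <= d * L.
    by rewrite cmodM cmodB ler_pM ?cmod_ge0 //; case: (HL _ (psiM t t1)).
  by lra.
have aB t j : cmod t <= 1 -> (2 <= j)%N -> cmod (a t)`_j <= B.
  by move=> t1 _; rewrite coef_taylor_residual HB ?psiM ?phi'M.
(* The roots are chosen pointwise, with no regularity in [t]; the iteration below shows that they
   depend on [t] as a disc. *)
have rootx t : exists x, cmod t <= 1 -> root (a t) x /\ cmod x * (k / 2) <= 2 * cmod (a t)`_0.
  have [t1|t1] := leP (cmod t) 1; last by exists 0.
  have [||j j2||x rx Hx] := Hd1 (a t); [exact: sa|exact: a1|exact: aB| |].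
    exact: le_trans (a0d t t1) dL1.
  by exists x.
have [xi Hxi] := choice rootx.
have xir t : cmod t <= 1 -> cmod (xi t) <= r / 2.
  move=> t1; have [_ Hx] := Hxi t t1; have := a0d t t1.
  by move=> a0L; rewrite -(ler_pM2r k2); lra.
exists (fun t => psi t + xi t); last first.
  move=> t t1; have [rx Hx] := Hxi t t1; split.
    by move/rootP: rx; rewrite horner_taylor_residual => /eqP; rewrite subr_eq0 => /eqP.
  move=> E; move: Hx; rewrite a0 // E subrr mul0r cmod0 mulr0 => Hx.
  have : cmod (xi t) == 0.
    by rewrite eq_le cmod_ge0 andbT -(ler_pM2r k2) mul0r.
  by rewrite cmod_eq0 => /eqP->; rewrite addr0.
apply: disc_approxD => //.
(* Newton's map with the derivative frozen at [h = 0]. It preserves [disc_approx], and its iterates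
   from 0 converge uniformly to [xi]. *)
pose T (h : C -> C) t := h t - (p.[psi t + h t] - phi' t * q.[psi t + h t]) *
   (p^`().[psi t] - phi' t * q^`().[psi t])^-1.
have aT h : disc_approx h -> disc_approx (T h).
  move=> ah; apply: disc_approxB => //; apply: disc_approxM.
    apply: disc_approxB; first by apply: disc_approx_horner; exact: disc_approxD.
    by apply: disc_approxM => //; apply: disc_approx_horner; exact: disc_approxD.
  apply: (disc_approxV k2); first by move=> t t1; rewrite -a1E a1.
  apply: disc_approxB; first exact: disc_approx_horner.
  by apply: disc_approxM => //; exact: disc_approx_horner.
pose h_ m := iter m T (fun=> 0).
have ah m : disc_approx (h_ m).
  by elim: m => [|m IH]; [exact: disc_approx_cst|exact: aT].
have hx m t : cmod t <= 1 -> cmod (h_ m t - xi t) <= 2^-1 ^+ m * (r / 2).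
  move=> t1; elim: m => [|m IH].
    by rewrite /h_ /= sub0r cmodN expr0 mul1r xir.
  have hr : cmod (h_ m t) <= r.
    have := cmodD (h_ m t - xi t) (xi t); rewrite subrK.
    have : 2^-1 ^+ m * (r / 2) <= 1 * (r / 2).
      by rewrite ler_pM2r ?divr_gt0 // exprn_ile1 // ?invf_le1 // ler1n.
    by have := xir t t1; lra.
  have xr : cmod (xi t) <= r by have := xir t t1; lra.
  have := poly_quad (sa t) r1 (fun j => aB t j t1) hr xr.
  have [/rootP rx _] := Hxi t t1; rewrite rx subr0 => Hq.
  have w0 : (a t)`_1 != 0 by rewrite -cmod_gt0 (lt_le_trans k2) ?a1.
  have -> : h_ m.+1 t - xi t =
     - ((a t).[h_ m t] - (a t)`_1 * (h_ m t - xi t)) / (a t)`_1.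
    by rewrite {1}/h_ /= -/(h_ m) /T -horner_taylor_residual -/(a t) -a1E; field.
  rewrite cmodM cmodN cmodV ler_pdivrMr ?cmod_gt0 //.
  apply: (le_trans Hq).
  apply: (@le_trans _ _ (k / 4 * cmod (h_ m t - xi t))).
    by rewrite ler_wpM2r ?cmod_ge0.
  apply: (@le_trans _ _ (2^-1 ^+ m.+1 * (r / 2) * (k / 2))); last first.
    by rewrite ler_wpM2l ?a1 // mulr_ge0 ?exprn_ge0 ?invr_ge0 // divr_ge0 // ltW.
  rewrite exprS; move: IH; move: (2^-1 ^+ m) => u IH.
  have : k / 4 * cmod (h_ m t - xi t) <= k / 4 * (u * (r / 2)).
    by rewrite ler_wpM2l // divr_ge0 // ltW.
  by move/le_trans; apply; rewrite le_eqVlt; apply/orP; left; apply/eqP; field.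
apply: disc_approx_limit => e e0.
have [|m Hm] := @exprn_le_eps R 2^-1 e _ e0.
  by apply/andP; split; [rewrite invr_ge0|rewrite invf_lt1 // ltr1n].
exists (h_ m); split=> // t t1; apply: (le_trans (hx m t t1)).
apply: (@le_trans _ _ (2^-1 ^+ m * 1)); last by rewrite mulr1.
by rewrite ler_wpM2l ?exprn_ge0 ?invr_ge0 //; lra.
Qed.

(** A homotopy replaces monodromy: the discs [P (s t)] are lifted for [s = i / (N + 1)], starting
    from the constant disc, with [N] so large that consecutive discs are within [d]. All have centre
    [P (0)], so the lifts keep the centre [z]. *)
Lemma lift_poly P z : (forall t, cmod t <= 1 -> D P.[t]) ->
  p.[z] = P.[0] * q.[z] ->
  exists2 psi, disc_approx psi & psi 0 = z /\
    forall t, cmod t <= 1 -> p.[psi t] = P.[t] * q.[psi t].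
Proof.
move=> DP Pz; have [d d0 Hd] := lift_step.
have [L L0 HL] := poly_lip P 1.
have [N HN] : exists N, L / d <= N.+1%:R.
  by exists (Num.trunc (L / d)); rewrite ltW // truncnS_gt.
pose s i : C := i%:R / N.+1%:R.
have N0 : (N.+1%:R : C) != 0 by rewrite pnatr_eq0.
have s1 i : (i <= N.+1)%N -> cmod (s i) <= 1.
  by move=> iN; rewrite cmodM cmodV !cmod_nat ler_pdivrMr ?ltr0n // mul1r ler_nat.
have st i t : (i <= N.+1)%N -> cmod t <= 1 -> cmod (s i * t) <= 1.
  by move=> iN t1; rewrite cmodM mulr_ile1 ?cmod_ge0 ?s1.
have step i : (i <= N.+1)%N -> exists2 psi, disc_approx psi & psi 0 = z /\
    forall t, cmod t <= 1 -> p.[psi t] = P.[s i * t] * q.[psi t].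
  elim: i => [_|i IH iN].
    exists (fun=> z); first exact: disc_approx_cst.
    by split=> // t t1; rewrite /s mul0r mul0r.
  have [psi apsi [psi0 Hpsi]] := IH (ltnW iN).
  have aphi : disc_approx (fun t => P.[s i.+1 * t]).
    apply: (disc_approx_ext _ (disc_approx_poly (P \Po (s i.+1 *: 'X)))) => t _.
    by rewrite horner_comp hornerZ hornerX.
  have [t t1|psi' apsi' Hpsi'] := Hd (fun t => P.[s i * t]) _ psi aphi apsi.
    split; [exact: DP _ (st _ _ (ltnW iN) t1)|exact: DP _ (st _ _ iN t1)|exact: Hpsi|].
    apply: (le_trans (HL _ _ (st _ _ (ltnW iN) t1) (st _ _ iN t1))).
    rewrite -mulrBl cmodM cmodB -mulrBl -natrB // subSnn cmodM cmodV cmod1 cmod_nat.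
    rewrite mul1r mulrA; apply: (@le_trans _ _ (L / N.+1%:R)).
      by rewrite ler_piMr // divr_ge0 // ltW.
    by rewrite ler_pdivrMr ?ltr0n // mulrC -ler_pdivrMr.
  exists psi' => //; split=> [|t t1]; last by have [] := Hpsi' t t1.
  have c0 : cmod (0 : C) <= 1 by rewrite cmod0.
  by have [_ ->] := Hpsi' 0 c0; rewrite ?mulr0.
have [psi apsi [psi0 Hpsi]] := step N.+1 (leqnn _).
exists psi => //; split=> // t t1; by rewrite Hpsi // /s divff // mul1r.
Qed.

(** The lift is replaced by a polynomial [Q] centred exactly at [z]. The chain rule holds for it up
    to [e], because [p (Q) - P q (Q)] is small on the disc and Cauchy's estimate bounds its linear
    coefficient. *)
Lemma lift_poly_approx P z (e : R) : 0 < e ->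
  (forall t, cmod t <= 1 -> D P.[t]) -> p.[z] = P.[0] * q.[z] ->
  exists Q, [/\ Q.[0] = z,
    forall t, cmod t <= 1 ->
      exists2 x, p.[x] = P.[t] * q.[x] & cmod (Q.[t] - x) <= e &
    cmod P`_1 * cmod q.[z] - e <=
      cmod Q`_1 * cmod (p^`().[z] - P.[0] * q^`().[z])].
Proof.
move=> e0 DP Pz; have [psi apsi [psi0 Hpsi]] := lift_poly DP Pz.
have [Lp Lp0 HLp] := poly_lip p (M + 2); have [Lq Lq0 HLq] := poly_lip q (M + 2).
have c0 : cmod (0 : C) <= 1 by rewrite cmod0.
have M0 : 0 <= M := le_trans (cmod_ge0 _) (DM (DP 0 c0)).
pose K := Lp + M * Lq + 1.
have K0 : 0 < K by rewrite addr_gt0 // ltr_pwDl // mulr_ge0 // ltW.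
pose d := Num.min (Num.min 1 (e / 2)) (e / K / 2).
have d0 : 0 < d by rewrite !lt_min ltr01 !divr_gt0.
have d1 : d <= 1 by rewrite !ge_min lexx.
have de : d <= e / 2 by rewrite !ge_min lexx orbT.
have dK : 2 * d * K <= e.
  have : d <= e / K / 2 by rewrite ge_min lexx orbT.
  by rewrite ler_pdivlMr // ler_pdivlMr // mulrAC mulrC mulrA.
have [Q0 HQ0] := apsi d d0.
(* Recentring at most doubles the error of approximation. *)
pose Q := Q0 + (z - Q0.[0])%:P.
have Qpsi t : cmod t <= 1 -> cmod (Q.[t] - psi t) <= 2 * d.
  move=> t1; rewrite hornerD hornerC.
  have -> : Q0.[t] + (z - Q0.[0]) - psi t = (Q0.[t] - psi t) + (psi 0 - Q0.[0]).
    by rewrite psi0; ring.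
  have := cmodD (Q0.[t] - psi t) (psi 0 - Q0.[0]).
  by rewrite [X in _ <= _ + X]cmodB; have := HQ0 t t1; have := HQ0 0 c0; lra.
have Qz : Q.[0] = z by rewrite hornerD hornerC; ring.
have psiM t : cmod t <= 1 -> cmod (psi t) <= M.
  by move=> t1; exact: DpreM (DP t t1) (Hpsi t t1).
exists Q; split=> // [t t1|].
  by exists (psi t); [exact: Hpsi|have := Qpsi t t1; lra].
pose E := p \Po Q - P * (q \Po Q).
have : cmod E`_1 <= e.
  apply: cauchy_poly => t t1; rewrite /E !hornerE !horner_comp.
  have -> : p.[Q.[t]] - P.[t] * q.[Q.[t]] =
     (p.[Q.[t]] - p.[psi t]) - P.[t] * (q.[Q.[t]] - q.[psi t]).
    by rewrite Hpsi //; ring.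
  have Qt := Qpsi t t1; have pt := psiM t t1.
  have QM : cmod Q.[t] <= M + 2.
    have := cmodD (Q.[t] - psi t) (psi t); rewrite subrK; lra.
  have pM2 : cmod (psi t) <= M + 2 by lra.
  apply: (le_trans (cmodBD _ _)); rewrite cmodM.
  have h1 : cmod (p.[Q.[t]] - p.[psi t]) <= Lp * (2 * d).
    by apply: (le_trans (HLp _ _ QM pM2)); rewrite ler_pM2l.
  have h2 : cmod (q.[Q.[t]] - q.[psi t]) <= Lq * (2 * d).
    by apply: (le_trans (HLq _ _ QM pM2)); rewrite ler_pM2l.
  have h3 : cmod P.[t] * cmod (q.[Q.[t]] - q.[psi t]) <= M * (Lq * (2 * d)).
    by rewrite ler_pM ?cmod_ge0 // DM //; exact: DP.
  apply: (le_trans (lerD h1 h3)); apply: le_trans dK; rewrite /K.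
  by rewrite -subr_ge0 (_ : _ - _ = 2 * d); [rewrite mulr_ge0 // ltW|ring].
have d0E (U : {poly C}) : U^`().[0] = U`_1 by rewrite horner_coef0 coef_deriv mulr1n.
have -> : E`_1 = p^`().[z] * Q`_1 - (P`_1 * q.[z] + P.[0] * (q^`().[z] * Q`_1)).
  rewrite -d0E /E derivB derivM !deriv_comp !hornerE !horner_comp Qz !d0E /=.
  by ring.
have := cmod_lB (P`_1 * q.[z]) (Q`_1 * (p^`().[z] - P.[0] * q^`().[z])).
rewrite !cmodM.
have -> : cmod (P`_1 * q.[z] - Q`_1 * (p^`().[z] - P.[0] * q^`().[z])) =
  cmod (p^`().[z] * Q`_1 - (P`_1 * q.[z] + P.[0] * (q^`().[z] * Q`_1))).
  by rewrite cmodB; congr cmod; ring.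
by lra.
Qed.

(* A lower bound on the Kobayashi-type extremal derivative of [D] at [z]. *)
Definition D_disc z (c : R) := exists P, [/\ P.[0] = z,
  forall t, cmod t <= 1 -> D P.[t] & c <= cmod P`_1].

Lemma D_disc_le z c : D_disc z c -> c <= M.
Proof.
move=> [P [_ DP cP]]; apply: (le_trans cP).
by apply: cauchy_poly => t t1; exact: DM (DP t t1).
Qed.

(* Tilting a lifted disc by [h t] uses the margin [h] between the preimage
   of [D] and the complement of [D]. *)
Lemma D_disc_pullback z y c (h : R) : 0 < h ->
  (forall x y x', D y -> p.[x] = y * q.[x] -> cmod (x' - x) < h -> D x') ->
  p.[z] = y * q.[z] -> D_disc y c ->
  D_disc z (c * cmod q.[z] / cmod (p^`().[z] - y * q^`().[z]) + h / 4).
Proof.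
move=> h0 Hh pz [P [P0 DP cP]].
have c0 : cmod (0 : C) <= 1 by rewrite cmod0.
have Dy : D y by rewrite -P0; exact: DP.
have kw := Dk Dy pz; set w := p^`().[z] - y * q^`().[z] in kw *.
have w0 : 0 < cmod w := lt_le_trans k0 kw.
(* With a tilt of modulus at most [h / 2], an error of [h / 4] stays within the margin [h]. The
   second bound limits the loss in the derivative to [h / 4], so [h / 4] of the tilt remains as
   gain. *)
pose e := Num.min (h / 4) (cmod w * (h / 4)).
have h4 : 0 < h / 4 by rewrite divr_gt0.
have e0 : 0 < e by rewrite lt_min h4 mulr_gt0.
have eh : e <= h / 4 by rewrite ge_min lexx.
have ew : e <= cmod w * (h / 4) by rewrite ge_min lexx orbT.
rewrite -P0 in pz; have [Q [Qz Qx Q1]] := lift_poly_approx e0 DP pz.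
rewrite P0 -/w in Q1.
(* The unit direction of the derivative, arbitrary if it vanishes, so that the tilt adds its whole
   modulus. *)
pose u : C := if Q`_1 == 0 then 1 else Q`_1 / (cmod Q`_1)%:C.
have u1 : cmod u = 1.
  rewrite /u; case: eqVneq => Q10; first by rewrite cmod1.
  rewrite cmodM cmodV cmod_realC ger0_norm ?cmod_ge0 // divff //.
  by rewrite cmod_eq0.
have Qu : Q`_1 = (cmod Q`_1)%:C * u.
  rewrite /u; case: eqVneq => [->|Q10]; first by rewrite cmod0 mul0r.
  by rewrite mulrC divfK // -[0]/(0%:C) (inj_eq (@complexI R)) cmod_eq0.
pose v : C := (h / 2)%:C * u.
have h2 : 0 < h / 2 by rewrite divr_gt0.
have cv : cmod v = h / 2 by rewrite cmodM u1 mulr1 cmod_realC ger0_norm // ltW.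
exists (Q + v *: 'X); split.
- by rewrite !hornerE Qz.
- move=> t t1; have [x px Hx] := Qx t t1.
  apply: (Hh x _ _ (DP t t1) px).
  have -> : (Q + v *: 'X).[t] - x = (Q.[t] - x) + v * t by rewrite !hornerE; ring.
  have := cmodD (Q.[t] - x) (v * t); rewrite cmodM cv.
  have : h / 2 * cmod t <= h / 2 * 1 by rewrite ler_pM2l.
  by lra.
- have -> : (Q + v *: 'X)`_1 = (cmod Q`_1 + h / 2)%:C * u.
    by rewrite coefD coefZ coefX mulr1 {1}Qu /v rmorphD mulrDl.
  rewrite cmodM u1 mulr1.
  rewrite cmod_realC ger0_norm; last by rewrite addr_ge0 ?cmod_ge0 // ltW.
  suff : c * cmod q.[z] / cmod w <= cmod Q`_1 + h / 4 by lra.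
  rewrite ler_pdivrMr // mulrDl.
  have : c * cmod q.[z] <= cmod P`_1 * cmod q.[z] by rewrite ler_wpM2r ?cmod_ge0.
  by move: Q1; lra.
Qed.

End Lifting.

(** * Topology and derivatives on the sphere *)

Section SphereTopology.
Variable R : realType.
Local Notation C := R[i].
Implicit Types (x y z w : C) (U : set (sphere R)).

Lemma cmod_le_ReIm z : cmod z <= `|complex.Re z| + `|complex.Im z|.
Proof.
case: z => a b; have E : (a +i* b)%C = a%:C + 'i%C * b%:C by simpc.
rewrite [X in cmod X]E (le_trans (cmodD _ _)) // cmodM !cmod_realC.
have -> : cmod ('i%C : C) = 1.
  by rewrite /cmod normc_def /= expr0n /= expr1n add0r sqrtr1.
by rewrite mul1r.
Qed.

Lemma Re_le_cmod z : `|complex.Re z| <= cmod z.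
Proof.
case: z => a b; rewrite /cmod normc_def /= -sqrtr_sqr.
by rewrite ler_wsqrtr // lerDl sqr_ge0.
Qed.

Lemma Im_le_cmod z : `|complex.Im z| <= cmod z.
Proof.
case: z => a b; rewrite /cmod normc_def /= -sqrtr_sqr.
by rewrite ler_wsqrtr // lerDr sqr_ge0.
Qed.

(** A positive element of [R[i]] has imaginary part 0, so the radii of balls are real. *)
Lemma nbhs_cmodP z (A : set C) : nbhs z A <->
  exists2 r : R, 0 < r & forall w, cmod (w - z) < r -> A w.
Proof.
split=> [/nbhs_ballP[e e0 He]|[r r0 Hr]].
  have e0' : 0 < e by [].
  case: e e0 e0' He => a b _; rewrite ltcE /= => /andP[/eqP b0 a0] He.
  exists a => // w wz; apply: He; rewrite -ball_normE /= cmodE cmodB b0.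
  by rewrite ltcE /= eqxx.
apply/nbhs_ballP; exists r%:C; first by rewrite /= ltcR.
by move=> w; rewrite -ball_normE /= cmodE ltcR cmodB => /Hr.
Qed.

Lemma compact_cmod_bounded (A : set C) : compact A ->
  exists M : R, forall w, A w -> cmod w <= M.
Proof.
move=> /compact_near_coveringP /(_ _ (pinfty_nbhs R) (fun i w => cmod w <= i) _) H.
have [|M [_ HM]] := H _.
  move=> x _; exists ([set w | cmod (w - x) < 1], [set i | cmod x + 1 < i]).
    split; first by apply/nbhs_cmodP; exists 1.
    by exists (cmod x + 1); split=> //; exact: num_real.
  case=> w i /= [wx xi]; have := cmodD (w - x) x; rewrite subrK; lra.
exists (M + 1) => w Aw; apply: (HM (M + 1)) Aw; by rewrite ltrDl.
Qed.

Lemma closed_cmod_ball (M : R) : closed [set w : C | cmod w <= M].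
Proof.
rewrite -[X in closed X]setCK; apply: open_closedC; rewrite openE => w /= /negP.
rewrite -ltNge => Mw; apply/nbhs_cmodP; exists (cmod w - M); first by lra.
move=> v vw /=; apply/negP; rewrite -ltNge.
by have := cmod_lB w (w - v); rewrite subKr [cmod (w - v)]cmodB; lra.
Qed.

Lemma compact_cmod_ball (M : R) : compact [set w : C | cmod w <= M].
Proof.
pose f (u : R * R) : C := (u.1 +i* u.2)%C.
have cf : continuous f.
  move=> [a b] A /nbhs_cmodP[r r0 Hr].
  exists (ball a (r / 2), ball b (r / 2)).
    by split; apply: nbhsx_ballx; rewrite divr_gt0.
  move=> [a' b'] /= []; rewrite -!ball_normE /= => Ha Hb; apply: Hr.
  apply: (le_lt_trans (cmod_le_ReIm _)); rewrite /f /= distrC.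
  by rewrite [X in _ + X]distrC; lra.
apply: (@subclosed_compact _ _ (f @` (`[- M, M] `*` `[- M, M]))).
- exact: closed_cmod_ball.
- apply: continuous_compact; first exact: continuous_subspaceT.
  by apply: compact_setX; exact: segment_compact.
- move=> w /= wM; exists (complex.Re w, complex.Im w); last by case: w {wM}.
  split; rewrite /= in_itv /= -ler_norml.
    exact: le_trans (Re_le_cmod w) wM.
  exact: le_trans (Im_le_cmod w) wM.
Qed.

Lemma nbhs_fin_ptP z U : nbhs (fin_pt z) U <->
  exists2 r : R, 0 < r & forall w, cmod (w - z) < r -> U (fin_pt w).
Proof.
split=> [H|H].
  have : nbhs z [set w | U (fin_pt w)] by exact: H.
  by move=> /nbhs_cmodP[r r0 Hr]; exists r.
have : nbhs z [set w | U (fin_pt w)] by apply/nbhs_cmodP.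
by [].
Qed.

Lemma nbhs_infty_ptP U : nbhs (infty_pt : sphere R) U <->
  U infty_pt /\ exists M : R, forall w, M < cmod w -> U (fin_pt w).
Proof.
split=> [[A [cA _] AU]|[Ui [M HM]]].
  split; first by apply: AU; right.
  have [M HM] := compact_cmod_bounded cA; exists M => w Mw.
  by apply: AU; left; exists w => //= /HM; rewrite leNgt Mw.
exists [set w | cmod w <= M].
  by split; [exact: compact_cmod_ball|exact: closed_cmod_ball].
move=> _ [[w /= /negP Mw <-]|->//]; apply: HM; by rewrite ltNge.
Qed.

Lemma open_fin_pt U : open U -> U !=set0 -> exists z, U (fin_pt z).
Proof.
move=> oU [[z|] Uz]; first by exists z.
have /nbhs_infty_ptP[_ [M HM]] : nbhs (infty_pt : sphere R) U.
  exact: open_nbhs_nbhs.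
exists (`|M| + 1)%:C; apply: HM; rewrite cmod_realC.
by rewrite ger0_norm ?addr_ge0 // (le_lt_trans (ler_norm M)) // ltrDl.
Qed.

End SphereTopology.

(** * Derivatives at finite points and homogeneous coordinates *)

Section SphereDerivative.
Variable R : realType.
Local Notation C := R[i].
Implicit Types (x y z w c b t u v : C) (f g : sphere R -> sphere R).

(** Finiteness of the values near [z] is built in, so that the chain rule applies to maps with poles
    elsewhere. *)
Definition fin_deriv f z w c := f (fin_pt z) = fin_pt w /\
  forall e : R, 0 < e -> exists2 d : R, 0 < d &
    forall h, cmod h <= d -> exists2 w', f (fin_pt (z + h)) = fin_pt w' &
      cmod (w' - w - c * h) <= e * cmod h.

Lemma fin_deriv_id z : fin_deriv id z z 1.
Proof.
split=> // e e0; exists 1 => // h _; exists (z + h) => //.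
have -> : z + h - z - 1 * h = 0 by ring.
by rewrite cmod0 mulr_ge0 ?cmod_ge0 // ltW.
Qed.

Lemma fin_deriv_comp f g z w v c b : fin_deriv f z w c -> fin_deriv g w v b ->
  fin_deriv (g \o f) z v (b * c).
Proof.
move=> [fz Hf] [gw Hg]; split=> [|e e0] /=; first by rewrite fz.
pose K := cmod b + cmod c + 2.
have K0 : 0 < K by rewrite /K; have := cmod_ge0 b; have := cmod_ge0 c; lra.
have eK : 0 < e / K by rewrite divr_gt0.
have [d1 d10 H1] := Hg _ eK.
pose e2 := Num.min 1 (e / K).
have e20 : 0 < e2 by rewrite lt_min ltr01.
have e21 : e2 <= 1 by rewrite ge_min lexx.
have e2K : e2 <= e / K by rewrite ge_min lexx orbT.
have [d2 d20 H2] := Hf _ e20.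
exists (Num.min d2 (d1 / K)); first by rewrite lt_min d20 divr_gt0.
move=> h; rewrite le_min => /andP[hd2 hd1].
have [w' fw' Hw'] := H2 h hd2.
have w'w : cmod (w' - w) <= (cmod c + 1) * cmod h.
  have := cmodD (w' - w - c * h) (c * h); rewrite subrK cmodM.
  have : e2 * cmod h <= 1 * cmod h by rewrite ler_wpM2r ?cmod_ge0.
  by lra.
have kd : cmod (w' - w) <= d1.
  apply: (le_trans w'w); apply: (@le_trans _ _ (K * cmod h)).
    by rewrite ler_wpM2r ?cmod_ge0 // /K; have := cmod_ge0 b; lra.
  by rewrite mulrC -ler_pdivlMr.
have [v' gv' Hv'] := H1 _ kd.
exists v'; first by rewrite fw' -gv' addrC subrK.
have -> : v' - v - b * c * h = (v' - v - b * (w' - w)) + b * (w' - w - c * h).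
  by ring.
apply: (le_trans (cmodD _ _)); rewrite cmodM.
apply: (@le_trans _ _ (e / K * ((cmod c + 1) * cmod h) + cmod b * (e / K * cmod h))).
  apply: lerD; first by apply: (le_trans Hv'); rewrite ler_pM2l.
  rewrite ler_wpM2l ?cmod_ge0 // (le_trans Hw') // ler_wpM2r ?cmod_ge0 //.
have KE : e = e / K * K by rewrite divfK // gt_eqF.
rewrite [X in _ <= X * _]KE; move: (e / K) eK => u u0; rewrite -subr_ge0.
have -> : u * K * cmod h - (u * ((cmod c + 1) * cmod h) + cmod b * (u * cmod h)) =
  u * cmod h by rewrite /K; ring.
by rewrite mulr_ge0 ?cmod_ge0 // ltW.
Qed.

Lemma fin_deriv_unique f z w c w' c' : fin_deriv f z w c ->
  fin_deriv f z w' c' -> w = w' /\ c = c'.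
Proof.
move=> [fz H1] [fz' H2].
have E : w = w' by move: fz'; rewrite fz => -[].
split=> //; apply/eqP; rewrite -subr_eq0 -cmod_eq0.
rewrite eq_le cmod_ge0 andbT; apply/ler_addgt0Pr => e e0; rewrite add0r.
have e2 : 0 < e / 2 by rewrite divr_gt0.
have [d1 d10 {}H1] := H1 _ e2; have [d2 d20 {}H2] := H2 _ e2.
pose d := Num.min d1 d2; have d0 : 0 < d by rewrite lt_min d10.
have cd : cmod (d%:C : C) = d by rewrite cmod_realC ger0_norm // ltW.
have [|u fu Hu] := H1 d%:C; first by rewrite cd ge_min lexx.
have [|u' fu' Hu'] := H2 d%:C; first by rewrite cd ge_min lexx orbT.
have Eu : u = u' by move: fu'; rewrite fu => -[].
subst w' u'; rewrite cd in Hu Hu'.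
have := cmodBD (u - w - c' * d%:C) (u - w - c * d%:C).
have -> : u - w - c' * d%:C - (u - w - c * d%:C) = (c - c') * d%:C by ring.
rewrite cmodM cd => H; rewrite -(ler_pM2r d0); lra.
Qed.

Lemma fin_deriv_sphere_deriv f z w c : fin_deriv f z w c ->
  sphere_deriv f (fin_pt z) = c.
Proof.
move=> [fz Hf]; rewrite /sphere_deriv /derive1; apply: cvg_lim.
  exact: norm_hausdorff.
move=> A /nbhs_cmodP[r r0 Hr].
have r2 : 0 < r / 2 by rewrite divr_gt0.
have [d d0 Hd] := Hf _ r2.
apply/nbhs_cmodP; exists d => // h; rewrite subr0 => hd h0.
apply: Hr; rewrite /local_expr /= fz !addr0 fz /= subrr.
have [w' -> Hw'] := Hd h (ltW hd).
rewrite /= subr0; have -> : h^-1 *: (w' - w) - c = (w' - w - c * h) * h^-1.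
  by rewrite mulrBl mulfK // /GRing.scale /= mulrC.
rewrite cmodM cmodV ltr_pdivrMr ?cmod_gt0 // (le_lt_trans Hw') //.
by rewrite ltr_pM2r ?cmod_gt0 // gtr_pMr // invf_lt1 // ltr1n.
Qed.

(** The point [[a : b]] of the projective line; the pair of zeros gets the junk value infinity. *)
Definition homog_pt (a b : C) : sphere R :=
  if b == 0 then infty_pt else fin_pt (a / b).

Lemma poly_order2 (p : {poly C}) : p`_0 = 0 -> p`_1 = 0 ->
  exists2 B : R, 0 < B & forall h, cmod h <= 1 -> cmod p.[h] <= B * cmod h ^+ 2.
Proof.
move=> p0 p1; have [B B0 HB] := poly_bound (drop_poly 2 p) 1.
exists B => // h h1; rewrite -[p](poly_take_drop 2).
have -> : take_poly 2 p = 0.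
  by apply/polyP => -[|[|i]]; rewrite coef_take_poly coef0.
by rewrite add0r hornerM hornerXn cmodM cmodX ler_wpM2r ?exprn_ge0 ?cmod_ge0 // HB.
Qed.

(** The quotient rule with an algebraic remainder: once denominators are cleared, the error is a
    polynomial [N] in [h] without terms of degree 0 and 1. *)
Lemma fin_deriv_homog f (p q : {poly C}) z :
  (forall t, f (fin_pt t) = homog_pt p.[t] q.[t]) -> q.[z] != 0 ->
  fin_deriv f z (p.[z] / q.[z])
    ((p^`().[z] * q.[z] - p.[z] * q^`().[z]) / q.[z] ^+ 2).
Proof.
move=> Hf qz; split=> [|e e0]; first by rewrite Hf /homog_pt (negPf qz).
pose ph := p \Po ('X + z%:P); pose qh := q \Po ('X + z%:P).
pose W := p^`().[z] * q.[z] - p.[z] * q^`().[z].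
have phE h : ph.[h] = p.[z + h] by rewrite horner_comp !hornerE addrC.
have qhE h : qh.[h] = q.[z + h] by rewrite horner_comp !hornerE addrC.
pose N := (q.[z] ^+ 2)%:P * ph - (p.[z] * q.[z])%:P * qh - W%:P * 'X * qh.
have NE h : N.[h] = q.[z] ^+ 2 * p.[z + h] - p.[z] * q.[z] * q.[z + h] -
     W * h * q.[z + h].
  by rewrite /N !hornerD !hornerN !hornerM !hornerC hornerX phE qhE.
have [||B B0 HB] := @poly_order2 N.
- by rewrite -horner_coef0 NE !addr0; ring.
- have -> : N`_1 = N^`().[0] by rewrite horner_coef0 coef_deriv mulr1n.
  rewrite /N /ph /qh !(derivB, derivM, derivC, derivX, deriv_comp, derivD).
  rewrite !(hornerD, hornerN, hornerM, hornerC, hornerX, horner_comp) /W add0r.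
  by ring.
have [L L0 HL] := poly_lip qh 1.
have cq : 0 < cmod q.[z] by rewrite cmod_gt0.
pose K := cmod q.[z] ^+ 3 / 2.
have K0 : 0 < K by rewrite divr_gt0 // exprn_gt0.
(* These bounds keep [|q.[z + h]|] above half of [|q.[z]|] and make the quadratic error at most
   [e * K * |h|], where [K] bounds the denominator from below. *)
pose d := Num.min (Num.min 1 (cmod q.[z] / 2 / L)) (e * K / B).
exists d; first by rewrite !lt_min ltr01 !divr_gt0 // mulr_gt0.
move=> h; rewrite !le_min => /andP[/andP[h1 hL] hB].
have qzh : cmod q.[z] / 2 <= cmod q.[z + h].
  have c0 : cmod (0 : C) <= 1 by rewrite cmod0.
  have := HL 0 h c0 h1; rewrite !qhE addr0 sub0r cmodN.
  have : L * cmod h <= cmod q.[z] / 2 by rewrite mulrC -ler_pdivlMr.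
  by have := cmod_lB q.[z] (q.[z] - q.[z + h]); rewrite subKr; lra.
have qzh0 : q.[z + h] != 0 by rewrite -cmod_gt0 (lt_le_trans _ qzh) // divr_gt0.
exists (p.[z + h] / q.[z + h]); first by rewrite Hf /homog_pt (negPf qzh0).
have -> : p.[z + h] / q.[z + h] - p.[z] / q.[z] -
   (p^`().[z] * q.[z] - p.[z] * q^`().[z]) / q.[z] ^+ 2 * h =
   N.[h] / (q.[z + h] * q.[z] ^+ 2).
  by rewrite NE /W; field; rewrite qz qzh0.
have KE : K <= cmod (q.[z + h] * q.[z] ^+ 2).
  rewrite cmodM cmodX /K exprS mulrAC ler_wpM2r ?exprn_ge0 ?cmod_ge0 //.
rewrite cmodM cmodV ler_pdivrMr ?(lt_le_trans K0) //.
apply: (le_trans (HB h h1)); apply: (@le_trans _ _ (e * cmod h * K)); last first.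
  by rewrite ler_wpM2l // mulr_ge0 ?cmod_ge0 // ltW.
rewrite expr2 mulrA [leRHS]mulrAC ler_wpM2r ?cmod_ge0 //.
by rewrite mulrC -ler_pdivlMr.
Qed.

Lemma ratmap_homog (p q : {poly C}) t :
  ratmap p q (fin_pt t) = homog_pt p.[t] q.[t].
Proof. by []. Qed.

(** The form of degree [n] attached to [p], evaluated at [(a, b)]; it stays meaningful where [b]
    vanishes. *)
Definition homogenize n (p a b : {poly C}) : {poly C} :=
  \sum_(i < n.+1) p`_i *: (a ^+ i * b ^+ (n - i)).

Lemma horner_homogenize n (p a b : {poly C}) t : (size p <= n.+1)%N ->
  (homogenize n p a b).[t] = if b.[t] == 0 then p`_n * a.[t] ^+ n
    else b.[t] ^+ n * p.[a.[t] / b.[t]].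
Proof.
move=> sp; rewrite /homogenize horner_sum.
under eq_bigr => i _ do rewrite hornerZ hornerM !horner_exp.
case: eqVneq => [->|b0].
  rewrite big_ord_recr /= subnn expr0 mulr1 big1 ?add0r // => i _.
  by rewrite expr0n subn_eq0 leqNgt ltn_ord /= mulr0 mulr0.
rewrite (horner_coef_wide _ sp) mulr_sumr; apply: eq_bigr => i _.
have -> : b.[t] ^+ n = b.[t] ^+ (n - i) * b.[t] ^+ i.
  by rewrite -exprD subnK // -ltnS.
by rewrite exprMn exprVn; field; rewrite expf_neq0.
Qed.

Definition no_common_zero (a b : {poly C}) :=
  forall t, a.[t] != 0 \/ b.[t] != 0.

(** Rationality in a form closed under composition without tracking degrees. Applied to the pair
    [('X, 1)], it yields polynomials without common zero that represent [g] at finite points. *)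
Definition homog_liftable g := forall a b : {poly C}, no_common_zero a b ->
  exists a' b' : {poly C}, no_common_zero a' b' /\
    forall t, g (homog_pt a.[t] b.[t]) = homog_pt a'.[t] b'.[t].

(** The two forms have no common zero: where [b] is nonzero by coprimality, and where [b] vanishes
    because one of the coefficients of degree [n] is nonzero. *)
Lemma homog_liftable_ratmap (p q : {poly C}) : coprimep p q -> q != 0 ->
  homog_liftable (ratmap p q).
Proof.
move=> pq q0 a b Hab; pose n := (maxn (size p) (size q)).-1.
have nS : n.+1 = maxn (size p) (size q).
  by rewrite prednK // leq_max !size_poly_gt0 q0 orbT.
have sp : (size p <= n.+1)%N by rewrite nS leq_maxl.
have sq : (size q <= n.+1)%N by rewrite nS leq_maxr.
have pqn : q`_n = 0 -> (size q < size p)%N /\ p`_n != 0.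
  move=> qn; have qp : (size q < size p)%N.
    rewrite ltnNge; apply: contra_eqN qn => pq'.
    by rewrite /n (maxn_idPr pq') -/(lead_coef q) lead_coef_eq0.
  split=> //; rewrite /n (maxn_idPl (ltnW qp)) -/(lead_coef p) lead_coef_eq0.
  by rewrite -size_poly_gt0 (leq_ltn_trans _ qp).
exists (homogenize n p a b), (homogenize n q a b); split=> t.
  rewrite !horner_homogenize //; case: (eqVneq b.[t] 0) => b0.
    have a0 : a.[t] != 0 by case: (Hab t) => //; rewrite b0 eqxx.
    have [qn|qn] := eqVneq q`_n 0; last by right; rewrite mulf_neq0 // expf_neq0.
    by left; have [_ pn] := pqn qn; rewrite mulf_neq0 // expf_neq0.
  have [p0|p0] := eqVneq p.[a.[t] / b.[t]] 0; last first.
    by left; rewrite mulf_neq0 // expf_neq0.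
  right; rewrite mulf_neq0 // ?expf_neq0 //.
  by rewrite -[_ == 0]/(root _ _) (coprimep_root pq) // rootE p0.
rewrite !horner_homogenize // /homog_pt; case: (eqVneq b.[t] 0) => b0.
  have a0 : a.[t] != 0 by case: (Hab t) => //; rewrite b0 eqxx.
  have [qn|qn] := eqVneq q`_n 0.
    by have [qp _] := pqn qn; rewrite qn mul0r eqxx /= qp.
  have pq' : (size p <= size q)%N.
    rewrite leqNgt; apply: contra_neqN qn => qp.
    by rewrite nth_default // /n (maxn_idPl (ltnW qp)) -ltnS prednK // (leq_ltn_trans _ qp).
  rewrite /= ltnNge pq' /= mulf_eq0 (negPf qn) expf_eq0 (negPf a0) andbF /=.
  have nq : n = (size q).-1 by rewrite /n (maxn_idPr pq').
  by rewrite /lead_coef -nq -mulf_div divff ?mulr1 // expf_neq0.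
rewrite /= mulf_eq0 expf_eq0 (negPf b0) andbF /=; case: eqVneq => // qn.
by rewrite -mulf_div divff ?mul1r // expf_neq0.
Qed.

Lemma homog_liftable_comp f g : homog_liftable f -> homog_liftable g ->
  homog_liftable (g \o f).
Proof.
move=> Hf Hg a b /Hf[a' [b' [/Hg[a'' [b'' [H E]] E']]]].
by exists a'', b''; split=> // t; rewrite /= E' E.
Qed.

(* A map omitting the disc of radius [r] around [v] is a bounded one in the
   coordinate [1 / (x - v)], to which Cauchy's estimate applies. *)
Lemma omitted_disc_deriv_le g z w c v (s r : R) : homog_liftable g ->
  0 < s -> 0 < r -> fin_deriv g z w c ->
  (forall t u, cmod (t - z) <= s -> g (fin_pt t) = fin_pt u -> r <= cmod (u - v)) ->
  cmod c * (s * r) <= cmod (w - v) ^+ 2.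
Proof.
move=> Hg s0 r0 dg Hom.
have [|a [b [Hab Eab]]] := Hg 'X 1.
  by move=> t; right; rewrite hornerC oner_eq0.
have {}Eab t : g (fin_pt t) = homog_pt a.[t] b.[t].
  by rewrite -Eab /homog_pt hornerC oner_eq0 hornerX divr1.
have bz : b.[z] != 0.
  apply/eqP => bz; case: dg => + _; rewrite Eab /homog_pt bz eqxx.
  by move=> E; discriminate E.
have [wE cE] := fin_deriv_unique dg (fin_deriv_homog Eab bz).
(* The quotient [b / y] is [1 / (g - v)], bounded by [1 / r] on the disc and equal to 0 at the poles
   of [g]. *)
pose y := a - v *: b.
have yb t : cmod (t - z) <= s -> y.[t] != 0 /\ cmod b.[t] <= r^-1 * cmod y.[t].
  move=> tz; have [bt|bt] := eqVneq b.[t] 0.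
    have [a0|] := Hab t; last by rewrite bt eqxx.
    by rewrite /y !hornerE bt mulr0 subr0 cmod0 mulr_ge0 ?invr_ge0 ?cmod_ge0 // ltW.
  have := Hom t (a.[t] / b.[t]) tz; rewrite Eab /homog_pt (negPf bt) => /(_ erefl) ra.
  have yE : y.[t] = (a.[t] / b.[t] - v) * b.[t] by rewrite /y !hornerE mulrBl divfK.
  split.
    by rewrite yE mulf_neq0 // -cmod_gt0 (lt_le_trans r0).
  by rewrite yE cmodM mulrA ler_peMl ?cmod_ge0 // mulrC ler_pdivlMr // mul1r.
pose l : {poly C} := s%:C *: 'X + z%:P.
have lE t : l.[t] = s%:C * t + z by rewrite /l !hornerE.
have := @cauchy_quotient R (b \Po l) (y \Po l) r^-1.
have c0E (p : {poly C}) : (p \Po l)`_0 = p.[z].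
  by rewrite -horner_coef0 horner_comp lE mulr0 add0r.
have c1E (p : {poly C}) : (p \Po l)`_1 = s%:C * p^`().[z].
  have -> : (p \Po l)`_1 = (p \Po l)^`().[0] by rewrite horner_coef0 coef_deriv mulr1n.
  rewrite deriv_comp hornerM horner_comp lE mulr0 add0r mulrC /l.
  by rewrite derivD derivZ derivX derivC !hornerE.
rewrite !c0E !c1E => H.
have {}H : cmod (s%:C * b^`().[z] * y.[z] - b.[z] * (s%:C * y^`().[z])) <=
    r^-1 * cmod y.[z] ^+ 2.
  apply: H; first by rewrite invr_ge0 ltW.
  move=> t t1; rewrite !horner_comp; apply: yb; rewrite lE addrK cmodM cmod_realC.
  by rewrite ger0_norm ?(ltW s0) // ler_piMr // ltW.
have yz : y.[z] = (w - v) * b.[z] by rewrite /y !hornerE wE mulrBl divfK.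
(* In [b' y - b y'] the terms in [v] cancel, which leaves the numerator of the derivative [c] of
   [a / b]. *)
have E : s%:C * b^`().[z] * y.[z] - b.[z] * (s%:C * y^`().[z]) =
   - s%:C * c * b.[z] ^+ 2.
  by rewrite cE /y derivB derivZ !(hornerD, hornerN, hornerZ); field.
move: H; rewrite E yz (cmodM _ (_ ^+ 2)) (cmodM (- _)) cmodN cmod_realC.
rewrite (ger0_norm (ltW s0)) cmodX cmodM exprMn.
have b2 : 0 < cmod b.[z] ^+ 2 by rewrite exprn_gt0 // cmod_gt0.
rewrite [leRHS]mulrA ler_pM2r // => H.
have -> : cmod c * (s * r) = r * (s * cmod c) by ring.
by rewrite -ler_pdivlMl.
Qed.

End SphereDerivative.

(** * Rational maps near infinity and near a repelling fixed point *)

Section Asymptotics.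
Variable R : realType.
Local Notation C := R[i].
Implicit Types (p q : {poly C}) (x y z w c : C) (f g : sphere R -> sphere R).

Lemma poly_growth_le p n : (size p <= n.+1)%N -> exists2 B : R, 0 < B &
  forall z, 1 <= cmod z -> cmod p.[z] <= B * cmod z ^+ n.
Proof.
move=> sp; exists (\sum_(i < n.+1) cmod p`_i + 1).
  by rewrite ltr_wpDl // sumr_ge0 // => i _; rewrite cmod_ge0.
move=> z z1; rewrite (horner_coef_wide _ sp) (le_trans (cmod_sum _ _ _)) //.
rewrite mulrDl mulr_suml ler_wpDr ?mul1r ?exprn_ge0 ?cmod_ge0 //.
apply: ler_sum => i _; rewrite cmodM cmodX ler_wpM2l ?cmod_ge0 //.
by rewrite ler_weXn2l // -ltnS.
Qed.

(** The last bound says that [z p' / p] is the degree of [p] up to [O(1 / |z|)]. Multiplying by ['X]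
    in [r] and [u] turns the cancellation of leading terms into this gain. *)
Lemma poly_infty p : p != 0 -> exists K M : R, [/\ 0 < K, 1 <= M &
  forall z, M < cmod z ->
    [/\ cmod (lead_coef p) / 2 * cmod z ^+ (size p).-1 <= cmod p.[z],
        cmod p.[z] <= 2 * cmod (lead_coef p) * cmod z ^+ (size p).-1 &
        cmod (z * p^`().[z] - (size p).-1%:R * p.[z]) * cmod z <= K * cmod p.[z]]].
Proof.
move=> p0; set n := (size p).-1; set a := lead_coef p.
have a0 : 0 < cmod a by rewrite cmod_gt0 lead_coef_eq0.
have sp : size p = n.+1 by rewrite prednK // size_poly_gt0.
have pn : p`_n = a by [].
pose r := (p - a *: 'X^n) * 'X.
have [|B B0 HB] := @poly_growth_le r n.
  apply/leq_sizeP => j nj; rewrite coefMX; case: eqVneq => // j0.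
  rewrite coefB coefZ coefXn; move: nj j0; case: j => // j; rewrite ltnS /= => nj _.
  case: eqVneq => [->|jn]; first by rewrite mulr1 pn subrr.
  by rewrite mulr0 subr0 nth_default // sp ltn_neqAle eq_sym jn.
pose u := ('X * p^`() - n%:R *: p) * 'X.
have [|B' B'0 HB'] := @poly_growth_le u n.
  apply/leq_sizeP => j nj; rewrite coefMX; case: eqVneq => // j0.
  rewrite coefB coefZ coefXM; move: nj j0; case: j => // j; rewrite ltnS /= => nj _.
  rewrite coef_deriv; move: nj; rewrite leq_eqVlt => /orP[/eqP<-|nj].
    by case: (n) => [|m] /=; rewrite ?mul0r ?subrr // mulr_natl subrr.
  by case: j nj => // j nj; rewrite /= nth_default ?sp // mul0rn mulr0 subrr.
exists (2 * B' / cmod a), (2 * B / cmod a + 1); split.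
- by rewrite divr_gt0 // mulr_gt0.
- by rewrite ler_wpDl // divr_ge0 ?cmod_ge0 // mulr_ge0 // ltW.
move=> z zM; have z1 : 1 <= cmod z.
  by apply/ltW/(le_lt_trans _ zM); rewrite ler_wpDl // divr_ge0 ?cmod_ge0 // mulr_ge0 // ltW.
have z0 : 0 < cmod z := lt_le_trans ltr01 z1.
have zn : 0 < cmod z ^+ n by rewrite exprn_gt0.
have H1 : cmod (p.[z] - a * z ^+ n) <= cmod a / 2 * cmod z ^+ n.
  have := HB z z1; rewrite /r hornerM hornerX hornerD hornerN hornerZ hornerXn cmodM => H.
  rewrite -(ler_pM2r z0) (le_trans H) // [leRHS]mulrAC ler_pM2r //.
  rewrite mulrAC ler_pdivlMr // mulrC -ler_pdivrMl // mulrC.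
  rewrite [leLHS](_ : _ = 2 * B / cmod a); last by ring.
  by apply/ltW/(lt_trans _ zM); rewrite ltrDl.
have L1 : cmod a / 2 * cmod z ^+ n <= cmod p.[z].
  have := cmod_lB (a * z ^+ n) (a * z ^+ n - p.[z]); rewrite subKr.
  by rewrite [cmod (_ - p.[z])]cmodB cmodM cmodX; lra.
split=> //.
  have := cmodD (p.[z] - a * z ^+ n) (a * z ^+ n).
  rewrite subrK (cmodM a) cmodX.
  have : 0 <= cmod a * cmod z ^+ n by rewrite mulr_ge0 // ltW.
  by lra.
have := HB' z z1; rewrite /u !hornerM hornerD hornerN hornerZ hornerM !hornerX cmodM => H.
rewrite (le_trans H) // mulrAC ler_pdivlMr // -mulrA mulrC.
apply: (@le_trans _ _ (2 * B' * (cmod a / 2 * cmod z ^+ n))).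
  by rewrite le_eqVlt; apply/orP; left; apply/eqP; field.
by rewrite ler_pM2l // mulr_gt0.
Qed.

Definition quot_deriv p q z := (p^`().[z] * q.[z] - p.[z] * q^`().[z]) / q.[z] ^+ 2.

(** The logarithmic derivative of [p / q] is the difference of those of [p] and [q], hence tends to
    the difference of the degrees. *)
Lemma logderiv_infty p q (e : R) : p != 0 -> q != 0 -> 0 < e ->
  exists2 M : R, 1 <= M & forall z, M < cmod z ->
    [/\ p.[z] != 0, q.[z] != 0 &
        cmod (z * quot_deriv p q z
              - ((size p).-1%:R - (size q).-1%:R) * (p.[z] / q.[z]))
        <= e * cmod (p.[z] / q.[z])].
Proof.
move=> p0 q0 e0.
have [Kp [Mp [Kp0 Mp1 Hp]]] := poly_infty p0.
have [Kq [Mq [Kq0 Mq1 Hq]]] := poly_infty q0.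
exists (Mp + Mq + (Kp + Kq) / e).
  by rewrite !ler_wpDr ?divr_ge0 ?addr_ge0 // ?(ltW Kp0) ?(ltW Kq0) ?(ltW e0) // (le_trans ler01).
move=> z zM.
have KKe : 0 < (Kp + Kq) / e by rewrite divr_gt0 // addr_gt0.
have zp : Mp < cmod z by lra.
have zq : Mq < cmod z by lra.
have ze : (Kp + Kq) / e < cmod z by lra.
have z0 : 0 < cmod z by lra.
have [p1 _ p2] := Hp z zp; have [q1 _ q2] := Hq z zq.
have pz : p.[z] != 0.
  rewrite -cmod_gt0 (lt_le_trans _ p1) // mulr_gt0 ?exprn_gt0 //.
  by rewrite divr_gt0 // cmod_gt0 lead_coef_eq0.
have qz : q.[z] != 0.
  rewrite -cmod_gt0 (lt_le_trans _ q1) // mulr_gt0 ?exprn_gt0 //.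
  by rewrite divr_gt0 // cmod_gt0 lead_coef_eq0.
split=> //.
set n : C := (size p).-1%:R in p2 *; set m : C := (size q).-1%:R in q2 *.
have -> : z * quot_deriv p q z - (n - m) * (p.[z] / q.[z]) =
  ((z * p^`().[z] - n * p.[z]) / p.[z] - (z * q^`().[z] - m * q.[z]) / q.[z])
  * (p.[z] / q.[z]).
  by rewrite /quot_deriv; field; rewrite qz pz.
rewrite cmodM ler_wpM2r ?cmod_ge0 // (le_trans (cmodBD _ _)) // !cmodM !cmodV.
rewrite -(ler_pM2r z0) mulrDl.
have h1 : cmod (z * p^`().[z] - n * p.[z]) / cmod p.[z] * cmod z <= Kp.
  by rewrite mulrAC ler_pdivrMr ?cmod_gt0.
have h2 : cmod (z * q^`().[z] - m * q.[z]) / cmod q.[z] * cmod z <= Kq.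
  by rewrite mulrAC ler_pdivrMr ?cmod_gt0.
have h3 : Kp + Kq <= e * cmod z by rewrite mulrC -ler_pdivrMr // ltW.
by lra.
Qed.

Lemma fin_deriv_ratmap p q z : q.[z] != 0 ->
  fin_deriv (ratmap p q) z (p.[z] / q.[z]) (quot_deriv p q z).
Proof. by move=> qz; apply: fin_deriv_homog. Qed.

(** A degree gap of at least 2 gives a logarithmic derivative of modulus at least [2 - 1/2] and at
    least quadratic growth. *)
Lemma superattracting_infty p q : (size q + 2 <= size p)%N -> q != 0 ->
  exists2 M : R, 1 <= M & forall z, M < cmod z -> exists w c,
    [/\ fin_deriv (ratmap p q) z w c, 2 * cmod z <= cmod w &
        3 / 2 * cmod w <= cmod (c * z)].
Proof.
move=> qp q0; have p0 : p != 0.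
  by rewrite -size_poly_gt0 (leq_trans _ qp) // addn2.
have [k kE] : exists k, (size p).-1 = ((size q).-1 + k.+2)%N.
  exists (size p - size q - 2)%N; move: qp q0; rewrite -size_poly_gt0.
  by move: (size p) (size q) => a b; clear; lia.
have [M1 M11 H1] := logderiv_infty p0 q0 (divr_gt0 ltr01 (ltr0Sn R 1)).
have [Kp [Mp [_ Mp1 Hp]]] := poly_infty p0.
have [Kq [Mq [_ Mq1 Hq]]] := poly_infty q0.
have lp : 0 < cmod (lead_coef p) by rewrite cmod_gt0 lead_coef_eq0.
have lq : 0 < cmod (lead_coef q) by rewrite cmod_gt0 lead_coef_eq0.
(* The quotient has modulus at least [|z| ^ 2] times a quarter of the ratio of the leading
   coefficients, which exceeds [2 |z|] from [A] on. *)
pose A := 8 * cmod (lead_coef q) / cmod (lead_coef p).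
have A0 : 0 < A by rewrite divr_gt0 // mulr_gt0.
exists (M1 + Mp + Mq + A); first by lra.
move=> z zM; have z1 : 1 <= cmod z by lra.
have z0 : 0 < cmod z by lra.
have [|pz qz H] := H1 z; first by lra.
have [|Hp1 _ _] := Hp z; first by lra.
have [|_ Hq1 _] := Hq z; first by lra.
have zA : A <= cmod z by lra.
exists (p.[z] / q.[z]), (quot_deriv p q z); split; first exact: fin_deriv_ratmap.
  rewrite cmodM cmodV ler_pdivlMr ?cmod_gt0 //; apply: le_trans Hp1.
  apply: (le_trans (ler_wpM2l _ Hq1)); first by rewrite mulr_ge0 ?cmod_ge0.
  rewrite kE exprD mulrCA [leRHS]mulrCA [leLHS]mulrCA.
  rewrite [leLHS](_ : _ = cmod z ^+ (size q).-1 * (4 * cmod (lead_coef q) * cmod z)); last by ring.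
  rewrite [leRHS](_ : _ = cmod z ^+ (size q).-1 * (cmod (lead_coef p) / 2 * cmod z ^+ k.+2)); last by ring.
  rewrite ler_pM2l ?exprn_gt0 // !exprS.
  have zk : 1 <= cmod z ^+ k by rewrite exprn_ege1.
  apply: (@le_trans _ _ (cmod (lead_coef p) / 2 * (cmod z * (cmod z * 1)))); last first.
    by rewrite ler_pM2l ?divr_gt0 // ler_pM2l // ler_pM2l.
  have : A * cmod (lead_coef p) <= cmod z * cmod (lead_coef p) by rewrite ler_pM2r.
  rewrite /A divfK ?gt_eqF // => HA.
  have := ler_wpM2r (ltW z0) HA; lra.
move: H; set w := p.[z] / q.[z]; set c := quot_deriv p q z => H.
have Hd : 2 <= cmod ((size p).-1%:R - (size q).-1%:R : C).
  by rewrite kE natrD addrAC subrr add0r cmod_nat ler_nat.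
rewrite [c * z]mulrC.
have := cmod_lB (((size p).-1%:R - (size q).-1%:R) * w)
  (((size p).-1%:R - (size q).-1%:R) * w - z * c).
rewrite subKr [cmod (_ * w - _)]cmodB (cmodM _ w).
have := ler_wpM2r (cmod_ge0 w) Hd; lra.
Qed.

(** The degrees differ by at least 1, so the logarithmic derivative has modulus at least
    [1 - 1/2]. *)
Lemma zero_at_infty p q : (size p < size q)%N -> p != 0 ->
  exists M A : R, 1 <= M /\ forall z, M < cmod z -> exists w c,
    [/\ fin_deriv (ratmap p q) z w c, w != 0, cmod w * cmod z <= A &
        2^-1 * cmod w <= cmod (c * z)].
Proof.
move=> pq p0; have q0 : q != 0 by rewrite -size_poly_gt0 (leq_ltn_trans _ pq).
have [k kE] : exists k, (size q).-1 = ((size p).-1 + k.+1)%N.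
  exists (size q - size p - 1)%N; move: pq p0; rewrite -size_poly_gt0.
  by move: (size p) (size q) => a b; clear; lia.
have [M1 M11 H1] := logderiv_infty p0 q0 (divr_gt0 ltr01 (ltr0Sn R 1)).
have [Kp [Mp [_ Mp1 Hp]]] := poly_infty p0.
have [Kq [Mq [_ Mq1 Hq]]] := poly_infty q0.
have lp : 0 < cmod (lead_coef p) by rewrite cmod_gt0 lead_coef_eq0.
have lq : 0 < cmod (lead_coef q) by rewrite cmod_gt0 lead_coef_eq0.
exists (M1 + Mp + Mq), (4 * cmod (lead_coef p) / cmod (lead_coef q)).
split; first by lra.
move=> z zM; have z1 : 1 <= cmod z by lra.
have z0 : 0 < cmod z by lra.
have [|pz qz H] := H1 z; first by lra.
have [|_ Hp1 _] := Hp z; first by lra.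
have [|Hq1 _ _] := Hq z; first by lra.
exists (p.[z] / q.[z]), (quot_deriv p q z); split; first exact: fin_deriv_ratmap.
- by rewrite mulf_neq0 // invr_eq0.
- rewrite cmodM cmodV mulrAC ler_pdivrMr ?cmod_gt0 //.
  apply: (@le_trans _ _ (4 * cmod (lead_coef p) / cmod (lead_coef q) *
     (cmod (lead_coef q) / 2 * cmod z ^+ (size q).-1))); last first.
    by rewrite ler_wpM2l // divr_ge0 ?mulr_ge0 // ltW.
  apply: (le_trans (ler_wpM2r (ltW z0) Hp1)).
  rewrite [leRHS](_ : _ = 2 * cmod (lead_coef p) * cmod z ^+ (size q).-1); last first.
    by field; rewrite gt_eqF.
  rewrite -[leLHS]mulrA ler_wpM2l ?mulr_ge0 ?cmod_ge0 // -exprSr ler_weXn2l //.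
  by rewrite kE -addSnnS leq_addr.
- move: H; set w := p.[z] / q.[z]; set c := quot_deriv p q z => H.
  have Hd : 1 <= cmod ((size p).-1%:R - (size q).-1%:R : C).
    by rewrite cmodB kE natrD addrAC subrr add0r cmod_nat ler1n.
  rewrite [c * z]mulrC.
  have := cmod_lB (((size p).-1%:R - (size q).-1%:R) * w)
    (((size p).-1%:R - (size q).-1%:R) * w - z * c).
  rewrite subKr [cmod (_ * w - _)]cmodB (cmodM _ w).
  have := ler_wpM2r (cmod_ge0 w) Hd; lra.
Qed.

(** Writing [p = p1 * 'X], the logarithmic derivative differs from 1 by [x (p1' / p1 - q' / q)],
    which is [O(|x|)]. *)
Lemma repelling_zero p q (m : C) : fin_deriv (ratmap p q) 0 0 m ->
  1 < cmod m ->
  exists r l L B : R, [/\ 0 < r, 1 < l, 0 < L, 0 < B &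
    forall x, 0 < cmod x <= r -> exists w c,
      [/\ fin_deriv (ratmap p q) x w c, l * cmod x <= cmod w,
          cmod w <= L * cmod x & cmod (c * x - w) <= B * cmod x * cmod w]].
Proof.
move=> dm m1.
have q0 : q.[0] != 0.
  by apply/eqP => q0; have [] := dm; rewrite ratmap_homog /homog_pt q0 eqxx => E; discriminate E.
have [p0 mE] := fin_deriv_unique dm (fin_deriv_ratmap p q0).
have {}p0 : p.[0] = 0.
  by apply/eqP; move/esym/eqP: p0; rewrite mulf_eq0 invr_eq0 (negPf q0) orbF.
have [p1 pE] : exists p1, p = p1 * 'X.
  have /factor_theorem[p1 ->] : root p 0 by rewrite rootE p0.
  by exists p1; rewrite subr0.
have dpE x : p^`().[x] = p1.[x] + p1^`().[x] * x.
  by rewrite pE derivM derivX !hornerE addrC.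
have p10 : p1.[0] != 0.
  apply/eqP => p10; move: m1; rewrite mE /quot_deriv dpE p10 p0 !(mulr0, mul0r, addr0, subr0).
  by rewrite cmod0 ltr10.
have cp : 0 < cmod p1.[0] by rewrite cmod_gt0.
have cq : 0 < cmod q.[0] by rewrite cmod_gt0.
(* Half of the excess of [|m|] over 1, so that the lower expansion factor [|m| - e] equals
   [1 + e]. *)
pose e := (cmod m - 1) / 2; have e0 : 0 < e by rewrite divr_gt0 // subr_gt0.
have [d d0 Hd] := dm.2 e e0.
have [Lp Lp0 HLp] := poly_lip p1 1; have [Lq Lq0 HLq] := poly_lip q 1.
have [Bp Bp0 HBp] := poly_bound p1^`() 1; have [Bq Bq0 HBq] := poly_bound q^`() 1.
pose r := Num.min (Num.min d 1) (Num.min (cmod p1.[0] / 2 / Lp) (cmod q.[0] / 2 / Lq)).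
exists r, (1 + e), (cmod m + e), (2 * Bp / cmod p1.[0] + 2 * Bq / cmod q.[0]).
split.
- by rewrite !lt_min d0 ltr01 !divr_gt0.
- by rewrite ltrDl.
- by rewrite addr_gt0 // (lt_trans ltr01).
- by rewrite addr_gt0 // divr_gt0 // mulr_gt0.
move=> x /andP[x0]; rewrite !le_min => /andP[/andP[xd x1] /andP[xp xq]].
have c0 : cmod (0 : C) <= 1 by rewrite cmod0.
have px : cmod p1.[0] / 2 <= cmod p1.[x].
  have := HLp 0 x c0 x1; rewrite sub0r cmodN.
  have : Lp * cmod x <= cmod p1.[0] / 2 by rewrite mulrC -ler_pdivlMr.
  by have := cmod_lB p1.[0] (p1.[0] - p1.[x]); rewrite subKr; lra.
have qx : cmod q.[0] / 2 <= cmod q.[x].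
  have := HLq 0 x c0 x1; rewrite sub0r cmodN.
  have : Lq * cmod x <= cmod q.[0] / 2 by rewrite mulrC -ler_pdivlMr.
  by have := cmod_lB q.[0] (q.[0] - q.[x]); rewrite subKr; lra.
have px0 : 0 < cmod p1.[x] by lra.
have qx0 : 0 < cmod q.[x] by lra.
have qxn : q.[x] != 0 by rewrite -cmod_gt0.
have pxn : p1.[x] != 0 by rewrite -cmod_gt0.
exists (p.[x] / q.[x]), (quot_deriv p q x).
have Hx : cmod (p.[x] / q.[x] - m * x) <= e * cmod x.
  have [w'] := Hd x xd; rewrite add0r subr0 (fin_deriv_ratmap p qxn).1.
  by move=> [<-].
split; first exact: fin_deriv_ratmap.
- have := cmod_lB (m * x) (m * x - p.[x] / q.[x]); rewrite subKr cmodB cmodM.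
  have -> : cmod m * cmod x = (2 * e + 1) * cmod x by rewrite /e; field.
  by lra.
- have := cmodD (p.[x] / q.[x] - m * x) (m * x); rewrite subrK cmodM; lra.
- have -> : quot_deriv p q x * x - p.[x] / q.[x] =
    (p1^`().[x] / p1.[x] - q^`().[x] / q.[x]) * x * (p.[x] / q.[x]).
    have px1 : p.[x] = p1.[x] * x by rewrite pE hornerM hornerX.
    by rewrite /quot_deriv dpE px1; field; rewrite pxn qxn.
  rewrite !(cmodM _ (_ / _)) (cmodM _ x) ler_wpM2r ?cmod_ge0 // ler_wpM2r ?cmod_ge0 //.
  rewrite (le_trans (cmodBD _ _)) // !cmodM !cmodV; apply: lerD.
    rewrite ler_pdivrMr // mulrAC ler_pdivlMr //.
    apply: (@le_trans _ _ (Bp * cmod p1.[0])); first by rewrite ler_wpM2r ?HBp // ltW.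
    have := ler_wpM2r (ltW Bp0) px; lra.
  rewrite ler_pdivrMr // mulrAC ler_pdivlMr //.
  apply: (@le_trans _ _ (Bq * cmod q.[0])); first by rewrite ler_wpM2r ?HBq // ltW.
  have := ler_wpM2r (ltW Bq0) qx; lra.
Qed.

(* Bounded distortion: along an orbit escaping from the repelling fixed point
   0 the moduli grow geometrically, so the factors [1 + O(|x|)] of the
   logarithmic derivative multiply to something bounded below. *)
Lemma escape_zero f (r l L B : R) : 0 < r -> 1 < l -> 0 < L -> 0 < B ->
  (forall x, 0 < cmod x <= r -> exists w c,
      [/\ fin_deriv f x w c, l * cmod x <= cmod w,
          cmod w <= L * cmod x & cmod (c * x - w) <= B * cmod x * cmod w]) ->
  exists2 r0 : R, 0 < r0 & forall x, 0 < cmod x < r0 -> exists k w c,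
      [/\ fin_deriv (iter k f) x w c, r0 <= cmod w <= L * r0 &
          2^-1 * cmod w <= cmod (c * x)].
Proof.
(* Since [B' * (l - 1) = B] and [|v| >= l |w|], the product of [1 - B |w|] and [1 - B' |w|] is at
   least [1 - B' |v|]: the product over the orbit telescopes. *)
move=> r0' l1 L0 B0 H; pose B' := B / (l - 1).
have l10 : 0 < l - 1 by rewrite subr_gt0.
have B'0 : 0 < B' by rewrite divr_gt0.
have B'E : B' * (l - 1) = B by rewrite divfK // gt_eqF.
(* The last term keeps [1 - B' |w|] above 1/2 up to modulus [L * r0], which the first point outside
   the disc of radius [r0] cannot exceed. *)
pose r0 := Num.min r (Num.min (2 * B)^-1 (2 * B' * L)^-1).
have B20 : 0 < 2 * B by rewrite mulr_gt0.
have r00 : 0 < r0 by rewrite !lt_min r0' !invr_gt0 B20 mulr_gt0 // mulr_gt0.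
have r0r : r0 <= r by rewrite ge_min lexx.
have r0B : B * r0 <= 2^-1.
  have : r0 <= (2 * B)^-1 by rewrite !ge_min lexx orbT.
  by rewrite invfM ler_pdivlMr // mulrC.
have r0L : B' * (L * r0) <= 2^-1.
  have : r0 <= (2 * B' * L)^-1 by rewrite !ge_min lexx !orbT.
  have BL0 : 0 < B' * L := mulr_gt0 B'0 L0.
  rewrite -mulrA invfM ler_pdivlMr // => h.
  by have -> : B' * (L * r0) = r0 * (B' * L) by ring.
exists r0 => // x /andP[x0 xr].
(* Either the orbit has already left the disc of radius [r0], or its modulus has grown by [l ^+ n],
   which is impossible for large [n]. *)
have step n : (exists k w c, [/\ fin_deriv (iter k f) x w c,
      r0 <= cmod w <= L * r0 & 2^-1 * cmod w <= cmod (c * x)]) \/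
    (exists w c, [/\ fin_deriv (iter n f) x w c, cmod w < r0,
       l ^+ n * cmod x <= cmod w & (1 - B' * cmod w) * cmod w <= cmod (c * x)]).
  elim: n => [|n [IH|[w [c [dw wr wl wc]]]]]; [right| by left|].
    exists x, 1; split; rewrite ?expr0 ?mul1r //; first exact: fin_deriv_id.
    by rewrite ler_piMl ?cmod_ge0 // gerBl mulr_ge0 ?cmod_ge0 // ltW.
  have w0 : 0 < cmod w.
    by rewrite (lt_le_trans _ wl) // mulr_gt0 // exprn_gt0 // (lt_trans ltr01).
  have [|v [b [dv lv vL bv]]] := H w.
    by rewrite w0 (le_trans (ltW wr)).
  have v0 : 0 < cmod v by rewrite (lt_le_trans _ lv) // mulr_gt0 // (lt_trans ltr01).
  have dvn : fin_deriv (iter n.+1 f) x v (b * c).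
    exact: (fin_deriv_comp dw dv).
  have bc : (1 - B' * cmod v) * cmod v <= cmod (b * c * x).
    have h1 : (1 - B * cmod w) * cmod v <= cmod b * cmod w.
      by have := cmod_lB v (v - b * w); rewrite subKr cmodB !cmodM; lra.
    have h2 : B * cmod w <= 2^-1.
      by apply: le_trans r0B; rewrite ler_pM2l // ltW.
    have h3 : (1 - B' * cmod v) * cmod v <=
        (1 - B * cmod w) * (1 - B' * cmod w) * cmod v.
      rewrite ler_pM2r //.
      have : B' * (l * cmod w) <= B' * cmod v by rewrite ler_pM2l.
      have : 0 <= B * cmod w * (B' * cmod w) by rewrite mulr_ge0 // mulr_ge0 // ltW.
      by rewrite -B'E; lra.
    have cE : cmod (b * c * x) = cmod b * cmod (c * x) by rewrite -mulrA cmodM.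
    rewrite cE; apply: (le_trans h3); rewrite -[leLHS]mulrA.
    have [neg|pos] := leP (1 - B' * cmod w) 0.
      apply: (@le_trans _ _ 0); last by rewrite mulr_ge0 ?cmod_ge0.
      by rewrite mulr_ge0_le0 ?mulr_le0_ge0 ?cmod_ge0 // subr_ge0; lra.
    apply: (@le_trans _ _ (cmod b * ((1 - B' * cmod w) * cmod w))); last first.
      by rewrite ler_wpM2l ?cmod_ge0.
    have := ler_wpM2l (ltW pos) h1; lra.
  have [vr|rv] := ltP (cmod v) r0.
    right; exists v, (b * c); split=> //.
    rewrite exprS -mulrA; apply: le_trans lv; rewrite ler_pM2l //.
    exact: lt_trans l1.
  left; exists n.+1, v, (b * c).
  have vLr : cmod v <= L * r0 by apply: (le_trans vL); rewrite ler_pM2l // ltW.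
  split=> //; first by rewrite rv.
  apply: le_trans bc; rewrite ler_pM2r //.
  have : B' * cmod v <= B' * (L * r0) by rewrite ler_pM2l.
  by lra.
have l01 : 0 <= l^-1 < 1.
  by rewrite invr_ge0 (le_trans ler01 (ltW l1)) /= invf_lt1 // (lt_trans ltr01).
have xr0 : 0 < cmod x / r0 / 2 by rewrite divr_gt0 // divr_gt0.
have [n Hn] := exprn_le_eps l01 xr0.
have [//|[w [c [_ wr wl _]]]] := step n.
have ln : 0 < l ^+ n by rewrite exprn_gt0 // (lt_trans ltr01).
have h : r0 < l ^+ n * cmod x.
  move: Hn; rewrite exprVn => Hn.
  have := ler_wpM2l (ltW ln) Hn; rewrite divff ?gt_eqF // => h.
  have := ler_wpM2r (ltW r00) h; rewrite mul1r.
  have -> : l ^+ n * (cmod x / r0 / 2) * r0 = l ^+ n * cmod x / 2.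
    by field; rewrite gt_eqF.
  by lra.
by have := lt_le_trans h wl; lra.
Qed.

(** Logarithmic derivatives multiply: [iter j f] contributes [(3 / 2) ^+ j], and [g] and the escape
    from 0 cost a factor 1/2 each. As [z] is fixed and the final modulus is at least [r0], the
    derivative itself becomes large. *)
Lemma derivative_blow_up f g (M A r0 M0 : R) z : 1 <= M -> 0 < r0 ->
  (forall z, M < cmod z -> exists w c, [/\ fin_deriv f z w c,
     2 * cmod z <= cmod w & 3 / 2 * cmod w <= cmod (c * z)]) ->
  (forall z, M < cmod z -> exists w c, [/\ fin_deriv g z w c, w != 0,
     cmod w * cmod z <= A & 2^-1 * cmod w <= cmod (c * z)]) ->
  (forall x, 0 < cmod x < r0 -> exists k w c, [/\ fin_deriv (iter k f) x w c,
     r0 <= cmod w <= M0 & 2^-1 * cmod w <= cmod (c * x)]) ->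
  M < cmod z -> forall K : R, exists k j w c,
    [/\ fin_deriv (iter k f \o g \o iter j f) z w c, cmod w <= M0 & K < cmod c].
Proof.
move=> M1 r00 Hf Hg H0 zM K.
have z0 : 0 < cmod z by lra.
have orb n : exists w c, [/\ fin_deriv (iter n f) z w c, M < cmod w,
    2 ^+ n * cmod z <= cmod w & (3 / 2) ^+ n * cmod w <= cmod (c * z)].
  elim: n => [|n [w [c [dw wM wz wc]]]].
    exists z, 1; split; rewrite ?expr0 ?mul1r //; exact: fin_deriv_id.
  have [v [b [dv wv vb]]] := Hf w wM; exists v, (b * c).
  have w0 : 0 < cmod w by lra.
  split; first exact: (fin_deriv_comp dw dv).
  - by lra.
  - by rewrite exprS -mulrA; lra.
  - rewrite -mulrA (cmodM b).
    apply: (@le_trans _ _ (cmod b * ((3 / 2) ^+ n * cmod w))).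
      move: vb; rewrite cmodM => vb.
      have := @ler_wpM2l R ((3 / 2) ^+ n) _ _ _ vb; rewrite exprS.
      move=> /(_ (exprn_ge0 _ _)) H; rewrite mulrCA [leLHS](_ : _ = (3 / 2) ^+ n * (3 / 2 * cmod v)); last by ring.
      by apply: H; rewrite divr_ge0.
    by rewrite ler_wpM2l ?cmod_ge0.
(* The first summand pushes the derivative beyond [K], the 4 paying for the two losses of 1/2; the
   second makes the image under [g] smaller than [r0]. *)
pose K' := `|K| * cmod z * 4 / r0 + `|A| / (r0 * cmod z) + 1.
have [n Hn] : exists n, (2 / 3 : R) ^+ n <= K'^-1.
  apply: exprn_le_eps; first by apply/andP; split; lra.
  by rewrite invr_gt0 ltr_wpDl // addr_ge0 ?divr_ge0 ?mulr_ge0 ?cmod_ge0 // ltW.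
have K'0 : 0 < K'.
  by rewrite ltr_wpDl // addr_ge0 ?divr_ge0 ?mulr_ge0 ?cmod_ge0 // ltW.
have HK : K' <= (3 / 2) ^+ n.
  rewrite -[K']invrK -[leRHS]invrK lef_pV2 ?posrE ?invr_gt0 ?exprn_gt0 ?divr_gt0 //.
  by rewrite -exprVn invf_div.
have [w [c [dw wM wz wc]]] := orb n.
have w0 : 0 < cmod w by lra.
have [v [b [dv v0 vA vb]]] := Hg w wM.
have cv0 : 0 < cmod v by rewrite cmod_gt0.
have vr : cmod v < r0.
  rewrite -(ltr_pM2r w0); apply: (le_lt_trans vA); apply: (le_lt_trans (ler_norm A)).
  have h1 : `|A| / (r0 * cmod z) < (3 / 2) ^+ n.
    apply: lt_le_trans HK; rewrite /K'.
    have : 0 <= `|K| * cmod z * 4 / r0.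
      by rewrite divr_ge0 ?mulr_ge0 ?cmod_ge0 // ltW.
    by lra.
  rewrite ltr_pdivrMr ?mulr_gt0 // in h1; apply: (lt_le_trans h1).
  rewrite mulrCA ler_pM2l //; apply: le_trans wz; rewrite ler_pM2r //.
  by rewrite lerXn2r ?nnegrE //; lra.
have [|k [u [a [du /andP[ru uM] ua]]]] := H0 v; first by rewrite cv0.
exists k, n, u, (a * (b * c)); split=> //.
  exact: (fin_deriv_comp (fin_deriv_comp dw dv) du).
have u0 : 0 < cmod u by lra.
have h : (3 / 2) ^+ n * 4^-1 * cmod u <= cmod (a * (b * c)) * cmod z.
  rewrite !cmodM -!mulrA; rewrite !cmodM in wc vb ua.
  apply: (@le_trans _ _ (cmod a * (cmod b * ((3 / 2) ^+ n * cmod w)))); last first.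
    by rewrite ler_wpM2l ?cmod_ge0 // ler_wpM2l ?cmod_ge0.
  apply: (@le_trans _ _ ((3 / 2) ^+ n * (cmod a * (2^-1 * cmod v)))); last first.
    rewrite mulrCA ler_wpM2l ?cmod_ge0 // [leRHS]mulrCA.
    by rewrite ler_wpM2l // exprn_ge0 // divr_ge0.
  rewrite ler_wpM2l ?exprn_ge0 ?divr_ge0 //; lra.
rewrite -(ltr_pM2r z0); apply: (lt_le_trans _ h).
apply: (@lt_le_trans _ _ (K' * 4^-1 * r0)).
  rewrite /K' !mulrDl.
  have -> : `|K| * cmod z * 4 / r0 / 4 * r0 = `|K| * cmod z by field; rewrite gt_eqF.
  have h1 : K * cmod z <= `|K| * cmod z by rewrite ler_pM2r // ler_norm.
  have h2 : 0 <= `|A| / (r0 * cmod z) / 4 * r0.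
    by rewrite mulr_ge0 ?divr_ge0 ?mulr_ge0 ?cmod_ge0 // ltW.
  by lra.
apply: ler_pM => //; [by rewrite mulr_ge0 // ltW|by rewrite ltW|].
by rewrite ler_pM2r.
Qed.

End Asymptotics.

(** * Trapping neighbourhoods of the attracting cycles *)

Section Traps.
Variable R : realType.
Local Notation C := R[i].
Variables f0 f1 : sphere R -> sphere R.
Hypothesis cf0 : continuous f0.
Hypothesis cf1 : continuous f1.
Implicit Types (x y : sphere R) (N : set (sphere R)) (g h : sphere R -> sphere R).

(** The monoid obtained by adjoining the identity, so that iterates of exponent 0 are included. *)
Definition word g := g = id \/ semigroup_gen f0 f1 g.

Lemma word_comp g h : word g -> word h -> word (g \o h).
Proof.
move=> [->|Gg] [->|Gh]; [by left|by right|by right|right].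
exact: SemigroupComp.
Qed.

Lemma word_iter0 n : word (iter n f0).
Proof.
elim: n => [|n IH]; first by left.
exact: (word_comp (or_intror (SemigroupGen0 f0 f1)) IH).
Qed.

Lemma word_iter1 n : word (iter n f1).
Proof.
elim: n => [|n IH]; first by left.
exact: (word_comp (or_intror (SemigroupGen1 f0 f1)) IH).
Qed.

Lemma semigroup_gen_compr g h : semigroup_gen f0 f1 g -> word h ->
  semigroup_gen f0 f1 (g \o h).
Proof. by move=> Gg [->//|Gh]; exact: SemigroupComp. Qed.

Lemma semigroup_gen_compl g h : word g -> semigroup_gen f0 f1 h ->
  semigroup_gen f0 f1 (g \o h).
Proof. by move=> [->//|Gg] Gh; exact: SemigroupComp. Qed.

Lemma word_ind (P : (sphere R -> sphere R) -> Prop) : P id -> P f0 -> P f1 ->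
  (forall g h, P g -> P h -> P (g \o h)) -> forall g, word g -> P g.
Proof. by move=> Pid P0 P1 Pc g [->//|]; elim=> // *; exact: Pc. Qed.

Lemma continuous_word g : word g -> continuous g.
Proof.
move: g; apply: word_ind => // [x|g h cg ch x]; first exact: cvg_id.
by apply: continuous_comp; [exact: ch|exact: cg].
Qed.

Lemma nbhs_preimage g x N : continuous g -> nbhs (g x) N ->
  nbhs x (g @^-1` N).
Proof. by move=> cg; exact: cg. Qed.

Definition far (M : R) : set (sphere R) :=
  [set x | if x is Some z then M < cmod z else True].

Lemma nbhs_far M x : far M x -> nbhs x (far M).
Proof.
case: x => [z|] /= Mz.
  apply/nbhs_fin_ptP; exists (cmod z - M); first by rewrite subr_gt0.
  by move=> w wz /=; have := cmod_lB z (z - w); rewrite subKr cmodB; lra.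
by apply/nbhs_infty_ptP; split => //; exists M.
Qed.

Variable M : R.

(** The last clause is the form in which hypothesis (c) is used: from the trap, some word leads near
    infinity, where derivatives can be made to blow up. *)
Definition trap N := [/\ closed N, forall x, N x -> nbhs (f0 x) N &
  forall x, N x -> exists2 g, word g & far M (g x)].

Lemma trapU N N' : trap N -> trap N' -> trap (N `|` N').
Proof.
move=> [cN fN gN] [cN' fN' gN']; split.
- exact: closedU.
- move=> x [/fN|/fN'] H; apply: filterS H => y; [by left|by right].
- by move=> x [/gN|/gN'].
Qed.

(** Enlarges a trap so that it contains points which enter it only after [k] steps, such as critical
    points. *)
Lemma trap_preimage N k : trap N -> trap (iter k f0 @^-1` N).
Proof.
move=> [cN fN gN]; have ck : continuous (iter k f0).
  exact: continuous_word (word_iter0 k).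
split.
- by apply: closed_comp => // x _; exact: ck.
- move=> x /= /fN; rewrite -iterS iterSr => H.
  exact: ck H.
- move=> x /= /gN[g wg Mg]; exists (g \o iter k f0) => //.
  exact: word_comp wg (word_iter0 k).
Qed.

Lemma closed_exists_lt (F : nat -> set (sphere R)) n :
  (forall j, closed (F j)) -> closed [set x | exists2 j, (j < n)%N & F j x].
Proof.
move=> cF; elim: n => [|n IH].
  rewrite (_ : mkset _ = set0); first exact: closed0.
  by rewrite -subset0 => x [j].
rewrite (_ : mkset _ = [set x | exists2 j, (j < n)%N & F j x] `|` F n).
  exact: closedU.
apply/seteqP; split=> x /=.
  move=> [j]; rewrite ltnS leq_eqVlt => /orP[/eqP->|jn] Fx; first by right.
  by left; exists j.
by move=> [[j jn Fx]|Fx]; [exists j => //; exact: ltnW|exists n].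
Qed.

Definition cball (a : C) (r : R) : set (sphere R) :=
  [set x | exists2 z, x = fin_pt z & cmod (z - a) <= r].

Lemma closed_cball a r : closed (cball a r).
Proof.
rewrite -[cball a r]setCK; apply: open_closedC; rewrite openE => -[z|] H.
  apply/nbhs_fin_ptP; exists (cmod (z - a) - r).
    by rewrite subr_gt0 ltNge; apply/negP => ra; apply: H; exists z.
  move=> w wz [_ [<-] wa]; have := cmod_tri z w a.
  by rewrite [cmod (z - w)]cmodB; lra.
apply/nbhs_infty_ptP; split; first by case.
exists (r + cmod a) => w rw [_ [<-] wa].
by have := cmodD (w - a) a; rewrite subrK; lra.
Qed.

Lemma nbhs_cball a (r s : R) x : r < s -> cball a r x -> nbhs x (cball a s).
Proof.
move=> rs [z -> za]; apply/nbhs_fin_ptP; exists (s - r); first by rewrite subr_gt0.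
move=> w wz; exists w => //; have := cmod_tri w z a; lra.
Qed.

(* The closed balls shrink along the cycle, so that [f0] maps the trap into
   its interior. *)
Lemma trap_attracting (a c : C) n : (0 < n)%N ->
  fin_deriv (iter n f0) a a c -> cmod c < 1 ->
  (exists2 g, word g & far M (g (fin_pt a))) ->
  exists2 N, trap N & nbhs (fin_pt a) N.
Proof.
move=> n0 [an dn] c1 [g wg Mg].
pose th := (1 + cmod c) / 2.
have th0 : 0 < th by rewrite /th; have := cmod_ge0 c; lra.
have th1 : th < 1 by rewrite /th; lra.
have [|r r0 Hr] := dn ((1 - cmod c) / 2); first by rewrite divr_gt0 // subr_gt0.
have contr z : cmod (z - a) <= r -> exists2 w,
    iter n f0 (fin_pt z) = fin_pt w & cmod (w - a) <= th * cmod (z - a).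
  move=> /Hr; rewrite addrC subrK => -[w -> Hw]; exists w => //.
  have := cmodD (w - a - c * (z - a)) (c * (z - a)); rewrite subrK cmodM /th; lra.
(* The radii decrease strictly from [r] to [th * r]. Applying [f0] lowers the index [j] by one and
   leaves room; from [j = 0], the contraction over a whole period leads to [j = n.-1]. *)
pose s j : R := r * (1 - (1 - th) * (j%:R / n%:R)).
have n0' : 0 < (n%:R : R) by rewrite ltr0n.
have sS i j : (i < j)%N -> s j < s i.
  move=> ij; rewrite /s ltr_pM2l // ltrD2l ltrN2 ltr_pM2l ?subr_gt0 //.
  by rewrite ltr_pM2r ?invr_gt0 // ltr_nat.
have s0 : s 0%N = r by rewrite /s mul0r mulr0 subr0 mulr1.
have sn : s n = th * r by rewrite /s divff ?gt_eqF // mulr1 subKr mulrC.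
have sr j : s j <= r.
  by rewrite -s0; case: j => // j; apply/ltW/sS.
pose N := [set x | exists2 j, (j < n)%N & cball a (s j) (iter j f0 x)].
have itc k : continuous (iter k f0) by exact: continuous_word (word_iter0 k).
have step x j : (j < n)%N -> cball a (s j.+1) (iter j f0 x) -> nbhs x N.
  move=> jn Hx; have H : nbhs x (iter j f0 @^-1` cball a (s j)).
    by apply: (nbhs_preimage (itc j)); exact: nbhs_cball (sS j j.+1 (ltnSn j)) Hx.
  by apply: filterS H => y Hy; exists j.
exists N; last first.
  apply/nbhs_fin_ptP; exists r => // w wa; exists 0%N => //=.
  by exists w => //; rewrite s0 ltW.
split.
- apply: closed_exists_lt => j; apply: closed_comp; last exact: closed_cball.
  by move=> x _; exact: itc.
- move=> x [[|j] jn Hx].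
    move: Hx => [z /= -> za]; rewrite s0 in za.
    have [w fw wz] := contr z za.
    apply: (step _ n.-1); first by rewrite prednK.
    rewrite -iterSr prednK // fw sn; exists w => //.
    by apply: (le_trans wz); rewrite ler_pM2l.
  apply: (step _ j (ltnW jn)); by rewrite -iterSr.
- move=> x [j jn [z xz za]].
  have {}za : cmod (z - a) <= r := le_trans za (sr j).
  have : nbhs (fin_pt a) (g @^-1` far M) by apply: (nbhs_preimage (continuous_word wg)); exact: nbhs_far.
  move=> /nbhs_fin_ptP[e e0 He].
  (* The return map brings the point so close to [a] that, by continuity, [g] sends it near infinity
     too. *)
  have it t : exists2 w, iter (t * n) f0 (fin_pt z) = fin_pt w &
      cmod (w - a) <= th ^+ t * r.
    elim: t => [|t [w fw wa]]; first by exists z; rewrite ?mul0n // expr0 mul1r.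
    have [|v fv va] := contr w.
      by apply: (le_trans wa); rewrite ler_piMl ?(ltW r0) // exprn_ile1 // ltW.
    exists v; first by rewrite mulSn iterD fw.
    by apply: (le_trans va); rewrite exprS -mulrA ler_pM2l.
  have [|t Ht] := @exprn_le_eps R th (e / r / 2) _ (divr_gt0 (divr_gt0 e0 r0) (ltr0Sn _ 1)).
    by rewrite ltW.
  have [w fw wa] := it t.
  exists (g \o (iter (t * n) f0 \o iter j f0)).
    by apply: word_comp => //; apply: word_comp; exact: word_iter0.
  rewrite /= xz fw; apply: He; apply: (le_lt_trans wa).
  have := ler_wpM2r (ltW r0) Ht.
  have -> : e / r / 2 * r = e / 2 by field; rewrite gt_eqF.
  by lra.
Qed.

Hypothesis f0_infty : f0 infty_pt = infty_pt.
Hypothesis f0_far : forall z : C, M < cmod z ->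
  exists2 w, f0 (fin_pt z) = fin_pt w & 2 * cmod z <= cmod w.
Hypothesis M1 : 1 <= M.

(** The bound [M + 1] puts this closed set inside the open set [far M]. *)
Definition trap_infty : set (sphere R) :=
  [set x | if x is Some z then M + 1 <= cmod z else True].

Lemma nbhs_trap_infty x : far (M + 1) x -> nbhs x trap_infty.
Proof.
move=> /nbhs_far; apply: filterS => -[z|] //= Mz; exact: ltW.
Qed.

Lemma trap_inftyP : trap trap_infty.
Proof.
split.
- rewrite -[trap_infty]setCK; apply: open_closedC; rewrite openE => -[z|] /= H.
    apply/nbhs_fin_ptP; exists (M + 1 - cmod z).
      by rewrite subr_gt0 ltNge; apply/negP.
    move=> w wz /= Mw; have := cmodD (w - z) z; rewrite subrK; lra.
  by case: H.
- move=> [z|] Hz; last by rewrite f0_infty; exact: nbhs_trap_infty.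
  change (is_true (M + 1 <= cmod z)) in Hz; have Mz : M < cmod z by lra.
  have [w fw zw] := f0_far Mz.
  have M0 : 0 < M := lt_le_trans ltr01 M1.
  have Mw : M + 1 < cmod w by lra.
  rewrite -[Some z]/(fin_pt z) fw.
  exact: nbhs_trap_infty.
- move=> x Hx; exists id; first by left.
  by case: x Hx => // z Hz; change (is_true (M + 1 <= cmod z)) in Hz; change (is_true (M < cmod z)); lra.
Qed.

(** Pointwise room is made uniform by the compactness of [N] in the sphere; near infinity, a
    displacement less than 1 keeps a point large. This [e] is the margin for tilting discs. *)
Lemma trap_margin N : trap N -> exists2 e : R, 0 < e &
  forall y y' : C, N (fin_pt y) -> cmod (y' - y) < e -> N (f0 (fin_pt y')).
Proof.
move=> [cN fN _].
have kN : compact N.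
  exact: subclosed_compact cN (@one_point_compactification_compact _) _.
have [|e [/= e0 He]] := (compact_near_coveringP N).1 kN _ (0^'+ : set_system R)
  (fun e x => forall y y' : C, x = fin_pt y -> cmod (y' - y) < e ->
     N (f0 (fin_pt y'))) _.
  move=> x Nx; have := nbhs_preimage cf0 (fN x Nx); case: x Nx => [z|] Nx.
    move=> /nbhs_fin_ptP[r r0 Hr].
    exists (cball z (r / 2), [set e | e < r / 2]).
      split; first by apply: (nbhs_cball (r := 0)); [exact: divr_gt0|exists z; rewrite // subrr cmod0].
      by apply: nbhs_right_lt; rewrite divr_gt0.
    move=> [x e] /= [[w -> wz] er] y y' [<-] yw; apply: Hr.
    by have := cmod_tri y' w z; lra.
  move=> /nbhs_infty_ptP[_ [K HK]].
  exists (far (K + 1), [set e | e < 1]).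
    by split; [exact: (@nbhs_far _ infty_pt)|exact: nbhs_right_lt].
  move=> [x e] /= [xf er] y y' xy yy; apply: HK; rewrite xy /= in xf.
  by have := cmod_lB y (y - y'); rewrite subKr [cmod (y - y')]cmodB; lra.
exists (e / 2); first by rewrite divr_gt0.
move=> y y' Ny yy; apply: (He (e / 2) _ _ (fin_pt y)) => //=.
- by rewrite sub0r normrN ger0_norm ?divr_ge0 // ?ltW //; lra.
- by rewrite divr_gt0.
Qed.

End Traps.

(** * The transitivity argument *)

Section GenericDerivative.
Variable R : realType.
Local Notation C := R[i].
Implicit Types (p q : {poly C}) (x z w c t : C) (f g h : sphere R -> sphere R).

Definition wronskian p q := p^`() * q - p * q^`().

Lemma quot_derivE p q z : quot_deriv p q z = (wronskian p q).[z] / q.[z] ^+ 2.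
Proof. by rewrite /quot_deriv /wronskian !(hornerD, hornerN, hornerM). Qed.

Lemma poly_roots p : p != 0 -> exists s : seq C, forall z, (p.[z] == 0) = (z \in s).
Proof.
move=> p0; have [s ps] := closed_field_poly_normal p; exists s => z.
rewrite {1}ps hornerZ mulf_eq0 lead_coef_eq0 (negPf p0) /=.
by rewrite -root_prod_XsubC.
Qed.

Lemma exists_notin (s : seq C) z (r : R) : 0 < r ->
  exists2 t, t \notin s & cmod (t - z) < r.
Proof.
move=> r0; pose F (k : nat) : C := z + (r / k.+2%:R)%:C.
have Finj : injective F.
  move=> i j /addrI/complexI/(mulfI (lt0r_neq0 r0))/invr_inj/eqP.
  by rewrite eqr_nat => /eqP[].
have Fr k : cmod (F k - z) < r.
  rewrite /F addrC addKr cmod_realC ger0_norm ?divr_ge0 ?(ltW r0) //.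
  by rewrite ltr_pdivrMr ?ltr0n // ltr_pMr // ltr1n.
have [/hasP[t]|/hasPn H] := boolP (has (fun t => t \notin s) (map F (iota 0 (size s).+1))).
  by move=> /mapP[k _ ->] ts; exists (F k).
have : (size (map F (iota 0 (size s).+1)) <= size s)%N.
  apply: uniq_leq_size; first by rewrite map_inj_uniq ?iota_uniq.
  by move=> t /H; rewrite negbK.
by rewrite size_map size_iota ltnn.
Qed.

(** Allows a point to be moved slightly so that the derivative of a given word is nonzero there. *)
Definition generic_deriv g := exists s : seq C, forall z, z \notin s ->
  exists w c, fin_deriv g z w c /\ c != 0.

Lemma generic_deriv_id : generic_deriv id.
Proof. by exists [::] => z _; exists z, 1; split; [exact: fin_deriv_id|exact: oner_neq0]. Qed.

Lemma generic_deriv_ratmap p q z : q.[z] != 0 -> quot_deriv p q z != 0 ->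
  generic_deriv (ratmap p q).
Proof.
move=> qz dz; have q0 : q != 0 by apply: contraNneq qz => ->; rewrite horner0.
have w0 : wronskian p q != 0.
  by apply: contraNneq dz; rewrite quot_derivE => ->; rewrite horner0 mul0r.
have [s1 H1] := poly_roots q0; have [s2 H2] := poly_roots w0.
exists (s1 ++ s2) => t; rewrite mem_cat -H1 -H2 negb_or => /andP[qt wt].
exists (p.[t] / q.[t]), (quot_deriv p q t); split; first exact: fin_deriv_ratmap.
by rewrite quot_derivE mulf_neq0 // invr_eq0 expf_neq0.
Qed.

(** The fibre lies among the roots of [a - x *: b]; were this polynomial zero, [h] would be constant
    and its derivative would vanish. *)
Lemma finite_fiber h x : homog_liftable h -> generic_deriv h ->
  exists s : seq C, forall t, h (fin_pt t) = fin_pt x -> t \in s.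
Proof.
move=> Hh [s0 Hs0]; have [|a [b [Hab Eab]]] := Hh 'X 1.
  by move=> t; right; rewrite hornerC oner_eq0.
have {}Eab t : h (fin_pt t) = homog_pt a.[t] b.[t].
  by rewrite -Eab /homog_pt hornerC oner_eq0 hornerX divr1.
have ab0 : a - x *: b != 0.
  apply/eqP => /eqP; rewrite subr_eq0 => /eqP ab.
  have [t ts _] := exists_notin s0 0 (ltr01 : 0 < (1 : R)).
  have [w [c [dt]]] := Hs0 t ts; apply/negP; rewrite negbK.
  have bt : b.[t] != 0.
    by case: (Hab t) => //; apply: contraNneq => bt; rewrite ab hornerZ bt mulr0.
  have [_ ->] := fin_deriv_unique dt (fin_deriv_homog Eab bt).
  by rewrite ab derivZ !hornerZ -!mulrA [_ * b.[t]]mulrC subrr mul0r.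
have [s Hs] := poly_roots ab0; exists s => t; rewrite Eab /homog_pt -Hs.
case: eqVneq => // bt [<-].
by rewrite !(hornerD, hornerN, hornerZ) divfK // subrr.
Qed.

(** The exceptional points are those of [h] and the preimages under [h] of those of [g], finitely
    many by [finite_fiber]. *)
Lemma generic_deriv_comp g h : homog_liftable h -> generic_deriv h ->
  generic_deriv g -> generic_deriv (g \o h).
Proof.
move=> Hh dh [sg Hg].
have [s Hs] : exists s : seq C, forall t x, x \in sg ->
    h (fin_pt t) = fin_pt x -> t \in s.
  elim: sg {Hg} => [|y sg [s IH]]; first by exists [::].
  have [s' Hs'] := finite_fiber y Hh dh; exists (s ++ s') => t x.
  rewrite inE mem_cat => /orP[/eqP->|xs] E; first by rewrite Hs' ?orbT.
  by rewrite (IH t x).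
have [sh Hsh] := dh; exists (sh ++ s) => t; rewrite mem_cat negb_or => /andP[th ts].
have [w [c [dt c0]]] := Hsh t th.
have [|v [b [dw b0]]] := Hg w.
  by apply: contra ts => wsg; apply: (Hs t w wsg); exact: dt.1.
exists v, (b * c); split; last exact: mulf_neq0.
exact: fin_deriv_comp dt dw.
Qed.

Lemma homog_liftable_id : homog_liftable (@id (sphere R)).
Proof. by move=> a b Hab; exists a, b. Qed.

Lemma generic_word f0 f1 g : homog_liftable f0 -> homog_liftable f1 ->
  generic_deriv f0 -> generic_deriv f1 -> word f0 f1 g ->
  homog_liftable g /\ generic_deriv g.
Proof.
move=> H0 H1 d0 d1; move: g.
apply: word_ind => //; first by split; [exact: homog_liftable_id|exact: generic_deriv_id].
move=> g h [Hg dg] [Hh dh]; split; first exact: homog_liftable_comp.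
exact: generic_deriv_comp.
Qed.

(** Infinity is fixed, so a finite last point forces the whole orbit to be finite, and the chain
    rule applies. *)
Lemma fin_deriv_iter p q n z w : (size q < size p)%N ->
  iter n (ratmap p q) (fin_pt z) = fin_pt w ->
  exists c, fin_deriv (iter n (ratmap p q)) z w c.
Proof.
move=> qp; elim: n w => [|n IH] w.
  by move=> [<-]; exists 1; exact: fin_deriv_id.
rewrite iterS; case E : (iter n _ _) => [v|]; last by rewrite /= qp.
have [c dc] := IH _ E; rewrite [ratmap p q _]/= => H.
have qv : q.[v] != 0 by apply/eqP => qv; rewrite qv eqxx in H.
move: H; rewrite (negPf qv) => -[<-].
by exists (quot_deriv p q v * c); exact: fin_deriv_comp dc (fin_deriv_ratmap p qv).
Qed.

Lemma poly_away_from_roots p (r : R) : p != 0 -> 0 < r ->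
  exists2 k : R, 0 < k & forall x, (forall c, root p c -> r <= cmod (x - c)) ->
    k <= cmod p.[x].
Proof.
move=> p0 r0; have [s ps] := closed_field_poly_normal p.
have l0 : 0 < cmod (lead_coef p) by rewrite cmod_gt0 lead_coef_eq0.
exists (cmod (lead_coef p) * r ^+ size s); first by rewrite mulr_gt0 // exprn_gt0.
move=> x Hx; rewrite {2}ps hornerZ cmodM ler_pM2l //.
have {}Hx c : c \in s -> r <= cmod (x - c).
  move=> cs; apply: Hx; rewrite ps rootE hornerZ mulf_eq0; apply/orP; right.
  by rewrite -[_ == 0]/(root _ c) root_prod_XsubC.
elim: s Hx {ps} => [|a s IH] Hx; first by rewrite big_nil hornerC cmod1.
rewrite big_cons hornerM hornerXsubC cmodM exprS ler_pM ?exprn_ge0 ?(ltW r0) //.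
  by apply: Hx; rewrite inE eqxx.
by apply: IH => c cs; apply: Hx; rewrite inE cs orbT.
Qed.

End GenericDerivative.

(** * Traps for a hyperbolic map and expansion in their complement *)

Section Hyperbolic.
Variable R : realType.
Local Notation C := R[i].
Variables (p q : {poly C}) (f1 : sphere R -> sphere R) (M : R).
Local Notation f0 := (ratmap p q).
Hypothesis cf0 : continuous f0.
Hypothesis cf1 : continuous f1.
Hypothesis qp : (size q < size p)%N.
Hypothesis f0_far : forall z : C, M < cmod z ->
  exists2 w, f0 (fin_pt z) = fin_pt w & 2 * cmod z <= cmod w.
Hypothesis M1 : 1 <= M.
Implicit Types (N : set (sphere R)) (c x y z w : C).

Lemma ratmap_infty : f0 infty_pt = infty_pt.
Proof. by rewrite /= qp. Qed.

(** For finite [a], iterating [f1] leads into the basin of infinity, after which iterates of [f0]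
    lead near infinity. *)
Lemma trap_of_attracting (a : sphere R) : attracting_periodic f0 a ->
  (a <> infty_pt -> exists k, immediate_basin_infty f0 (iter k f1 a)) ->
  exists2 N, trap f0 f1 M N & nbhs a N.
Proof.
move=> [n [n0 an dn]]; case: a an dn => [a|] an dn Ha; last first.
  exists (trap_infty M); first exact: (trap_inftyP _ ratmap_infty f0_far M1).
  exact: (@nbhs_trap_infty _ M infty_pt).
have [c dc] := fin_deriv_iter qp an.
apply: (trap_attracting cf0 cf1 n0 dc).
  by move: dn; rewrite (fin_deriv_sphere_deriv dc) cmodE -[1]/(1%:C) ltcR.
have [//|k /connected_component_sub /= Hk] := Ha.
have /Hk [m _ Hm] : nbhs (infty_pt : sphere R) (far M) by exact: (@nbhs_far _ M infty_pt).
exists (iter m f0 \o iter k f1); last exact: (Hm m (leqnn m)).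
by apply: word_comp; [exact: word_iter0|exact: word_iter1].
Qed.

Lemma attracted_meets_trap (a x : sphere R) N : attracting_periodic f0 a -> nbhs a N ->
  (fun k => iter k f0 x) @ \oo `=>` set_nbhs (forward_orbit f0 a) ->
  exists k, nbhs (iter k f0 x) N.
Proof.
move=> [n [n0 an _]] aN Hx.
pose E := [set y | exists k, nbhs (iter k f0 y) N].
have itn t : iter (t * n) f0 a = a.
  by elim: t => // t IH; rewrite mulSn iterD IH.
have /Hx [m _ Hm] : set_nbhs (forward_orbit f0 a) E.
  move=> _ [i _ <-].
  (* [N] surrounds [a] only; [i * n - i] more steps complete [i] periods and bring the other points
     of the cycle back to [a]. *)
  have E0 : iter (i * n - i) f0 (iter i f0 a) = a.
    by rewrite -iterD subnK ?itn // leq_pmulr.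
  have : nbhs (iter i f0 a) (iter (i * n - i) f0 @^-1` (interior N)).
    apply: nbhs_preimage.
      exact: (continuous_word cf0 cf1 (word_iter0 f0 f1 (i * n - i))).
    by rewrite E0; exact: nbhs_interior.
  by apply: filterS => y Hy; exists (i * n - i)%N.
have [k Hk] := Hm m (leqnn m).
by exists (k + m)%N; rewrite iterD.
Qed.

Lemma critical_trap (s : seq C) :
  (forall c, c \in s -> exists2 N, trap f0 f1 M N & nbhs (f0 (fin_pt c)) N) ->
  exists N, [/\ trap f0 f1 M N, trap_infty M `<=` N &
    forall c, c \in s -> nbhs (f0 (fin_pt c)) N].
Proof.
elim: s => [_|a s IH H].
  exists (trap_infty M); split=> //.
  exact: (trap_inftyP _ ratmap_infty f0_far M1).
have [|N [tN iN HN]] := IH; first by move=> c cs; apply: H; rewrite inE cs orbT.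
have [|N' tN' aN'] := H a; first by rewrite inE eqxx.
exists (N `|` N'); split; first exact: trapU.
  by move=> x /iN Nx; left.
move=> c; rewrite inE => /orP[/eqP->|/HN cN].
  by apply: filterS aN' => x; right.
by apply: filterS cN => x; left.
Qed.

Lemma critical_margin (s : seq C) N :
  (forall c, c \in s -> nbhs (f0 (fin_pt c)) N) ->
  exists2 r : R, 0 < r &
    forall c z, c \in s -> cmod (z - c) < r -> N (f0 (fin_pt z)).
Proof.
elim: s => [_|a s IH H]; first by exists 1.
have [|r r0 Hr] := IH; first by move=> c cs; apply: H; rewrite inE cs orbT.
have /nbhs_fin_ptP[r' r'0 Hr'] : nbhs (fin_pt a) (f0 @^-1` N).
  by apply: nbhs_preimage => //; apply: H; rewrite inE eqxx.
exists (Num.min r r'); first by rewrite lt_min r0.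
move=> c z; rewrite inE lt_min => /orP[/eqP->|cs] /andP[zr zr'].
  exact: Hr'.
exact: Hr cs zr.
Qed.

(* Pulling discs back along the orbit of [z] produces a disc in the complement
   of the trap whose derivative grows linearly with the length of the orbit. *)
Lemma escapes_or_unbounded_deriv N z (K : R) : coprimep p q ->
  wronskian p q != 0 -> trap f0 f1 M N -> trap_infty M `<=` N ->
  (forall c, root (wronskian p q) c -> nbhs (f0 (fin_pt c)) N) ->
  (forall n, ~ N (iter n f0 (fin_pt z))) ->
  (forall n w c, fin_deriv (iter n f0) z w c -> cmod w <= M + 1 -> cmod c <= K) ->
  False.
Proof.
move=> cpq w0 tN iN HN Hz HK.
have [s Hs] := poly_roots w0.
have [|r r0 Hr] := @critical_margin s N.
  by move=> c; rewrite -Hs => cs; exact: HN.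
have [k k0 Hk] := poly_away_from_roots w0 r0.
have [B B0 HB] := poly_bound q (M + 1).
pose D y := ~ N (fin_pt y).
have DM y : D y -> cmod y <= M + 1.
  by move=> Dy; rewrite leNgt; apply/negP => My; apply: Dy; apply: iN; exact: ltW.
have M0 : 0 < M := lt_le_trans ltr01 M1.
have qx x y : p.[x] = y * q.[x] -> q.[x] != 0.
  move=> pxy; apply: contraTneq cpq => q0; apply/negP => cpq.
  have : root p x by rewrite rootE pxy q0 mulr0.
  by move/(coprimep_root cpq); rewrite q0 eqxx.
have fx x y : p.[x] = y * q.[x] -> f0 (fin_pt x) = fin_pt y.
  move=> pxy; rewrite ratmap_homog /homog_pt (negPf (qx _ _ pxy)) pxy mulfK //.
  exact: qx pxy.
have DpreD x y : D y -> p.[x] = y * q.[x] -> D x.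
  move=> Dy /fx fxy Nx; apply: Dy; rewrite -fxy.
  by case: tN => _ fN _; exact: nbhs_singleton (fN _ Nx).
(* At a preimage of [y] the Wronskian is [q] times [p' - y q']. Preimages of [D] stay at distance
   [r] from its roots, since [f0] maps the points nearer to them into [N]. *)
have Dk x y : D y -> p.[x] = y * q.[x] ->
    k / B <= cmod (p^`().[x] - y * q^`().[x]).
  move=> Dy pxy; have Dx := DpreD _ _ Dy pxy.
  have q0 : 0 < cmod q.[x] by rewrite cmod_gt0 (qx _ _ pxy).
  have E : (wronskian p q).[x] = (p^`().[x] - y * q^`().[x]) * q.[x].
    by rewrite /wronskian !(hornerD, hornerN, hornerM) pxy; ring.
  have kW : k <= cmod (wronskian p q).[x].
    apply: Hk => c cW; rewrite leNgt; apply/negP => cr.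
    apply: Dy; rewrite -(fx _ _ pxy); apply: Hr cr.
    by rewrite -Hs -[_ == 0]/(root _ c).
  rewrite ler_pdivrMr //; apply: (le_trans kW); rewrite E cmodM.
  by rewrite ler_wpM2l ?cmod_ge0 // HB // DM.
have [e e0 He] := trap_margin cf0 tN.
have Hmar x y x' : D y -> p.[x] = y * q.[x] -> cmod (x' - x) < e -> D x'.
  move=> Dy pxy xx Nx'; apply: Dy; rewrite -(fx _ _ pxy).
  by apply: (He _ _ Nx'); rewrite cmodB.
have orb n : exists w c, [/\ fin_deriv (iter n f0) z w c, D w & cmod c <= K].
  case E : (iter n f0 (fin_pt z)) => [w|]; last first.
    by case: (Hz n); rewrite E; exact: iN.
  have Dw : D w by move=> Nw; apply: (Hz n); rewrite E.
  have [c dc] := fin_deriv_iter qp E; exists w, c; split=> //.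
  by apply: (HK _ _ _ dc); exact: DM.
have K0 : 0 < K.
  have [w [c [dc _ cK]]] := orb 0%N.
  have [_ cE] := fin_deriv_unique dc (fin_deriv_id z).
  by apply: lt_le_trans cK; rewrite cE cmod1.
have kB0 : 0 < k / B by rewrite divr_gt0.
(* Pulling back from the next orbit point divides by the derivative of [f0], so the factor there
   becomes [cmod c]; the tilt adds [e / 4], at least [e / 4 * (cmod c / K)]. Hence the induction on
   [m] is for all [n] at once, and [n = 0] gives the contradiction. *)
have main m : forall n w c, fin_deriv (iter n f0) z w c ->
    D_disc D w (e / 4 * (cmod c * m%:R / K)).
  elim: m => [|m IH] n w c dc.
    have [w' [c' [dc' Dw _]]] := orb n.
    have [Ew _] := fin_deriv_unique dc dc'; rewrite -Ew in Dw.
    exists w%:P; split=> [|t _|]; rewrite ?hornerC //.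
    by rewrite mulr0 mul0r mulr0 cmod_ge0.
  have [v [b [db Dv bK]]] := orb n.+1.
  have [w' [c' [dc' Dw cK]]] := orb n.
  have [Ew Ec] := fin_deriv_unique dc dc'; rewrite -Ec in cK.
  have fwv : f0 (fin_pt w) = fin_pt v.
    by have := db.1; rewrite iterS dc.1.
  have qw : q.[w] != 0.
    by apply/eqP => qw; move: fwv; rewrite ratmap_homog /homog_pt qw eqxx.
  have pwv : p.[w] = v * q.[w].
    by move: fwv; rewrite ratmap_homog /homog_pt (negPf qw) => -[<-]; rewrite divfK.
  have := D_disc_pullback kB0 DM (fun x y Dy E => DM _ (DpreD x y Dy E)) Dk e0 Hmar
    pwv (IH _ _ _ db).
  have [_ bE] := fin_deriv_unique db (fin_deriv_comp dc (fin_deriv_ratmap p qw)).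
  set D' := p^`().[w] - v * q^`().[w].
  have dE : quot_deriv p q w = D' / q.[w].
    by rewrite /quot_deriv pwv /D'; field.
  have D'0 : 0 < cmod D' by apply: lt_le_trans (Dk _ _ Dv pwv).
  have cq : 0 < cmod q.[w] by rewrite cmod_gt0.
  rewrite bE dE !cmodM cmodV.
  have -> : e / 4 * (cmod D' / cmod q.[w] * cmod c * m%:R / K) * cmod q.[w] / cmod D' =
      e / 4 * (cmod c * m%:R / K).
    by field; rewrite !gt_eqF.
  move=> [P [P0 PD Pc]]; exists P; split=> //; apply: le_trans Pc.
  have cK1 : cmod c / K <= 1 by rewrite ler_pdivrMr // mul1r.
  have -> : e / 4 * (cmod c * m.+1%:R / K) =
      e / 4 * (cmod c * m%:R / K) + e / 4 * (cmod c / K).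
    by rewrite -[m.+1%:R]natr1; ring.
  by rewrite lerD2l ler_piMr // divr_ge0 // ltW.
have e4 : 0 < e / 4 by rewrite divr_gt0.
have [m Hm] : exists m, (M + 1) * K / (e / 4) < m.+1%:R.
  by exists (Num.trunc ((M + 1) * K / (e / 4))); rewrite truncnS_gt.
have := D_disc_le DM (main m.+1 0%N z 1 (fin_deriv_id z)).
rewrite cmod1 mul1r => H; move: Hm; rewrite ltNge => /negP; apply.
rewrite ler_pdivlMr // mulrC.
by move: H; rewrite mulrA ler_pdivrMr.
Qed.

End Hyperbolic.

(** * Transitivity for a single parameter *)

Section Transitivity.
Variable R : realType.
Local Notation C := R[i].
Implicit Types (p q : {poly C}) (U V : set (sphere R)).

(** If the degrees differed by 1, the map would be of order [h] in the coordinate at infinity, and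
    its quotient by [h ^+ d] would be unbounded. One large real point [z] suffices to contradict the
    limit [c]. *)
Lemma local_degree_size p q d : (size q < size p)%N -> q != 0 -> (2 <= d)%N ->
  local_degree (ratmap p q) infty_pt d -> (size q + 2 <= size p)%N.
Proof.
move=> qp q0 d2 [_ [c c0 lc]]; rewrite leqNgt; apply/negP => sp.
have p0 : p != 0 by rewrite -size_poly_gt0 (leq_ltn_trans _ qp).
have spq : (size p).-1 = (size q).-1.+1.
  have Ep : size p = (size q).+1.
    by apply/eqP; rewrite eqn_leq qp andbT; move: sp; rewrite addn2 ltnS.
  by rewrite Ep prednK // size_poly_gt0.
have [Kp [Mp [_ Mp1 Hp]]] := poly_infty p0.
have [Kq [Mq [_ Mq1 Hq]]] := poly_infty q0.
have lp : 0 < cmod (lead_coef p) by rewrite cmod_gt0 lead_coef_eq0.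
have lq : 0 < cmod (lead_coef q) by rewrite cmod_gt0 lead_coef_eq0.
have c1 : nbhs c [set w | cmod (w - c) < 1] by apply/nbhs_cmodP; exists 1.
have /nbhs_cmodP[r r0 Hr] : nbhs (0 : C) [set h | h != 0 ->
    cmod (local_expr (ratmap p q) infty_pt h / h ^+ d - c) < 1].
  exact: (lc _ c1).
(* Beyond [T] the asymptotic bounds hold and [1 / z] is within [r] of 0; the last term forces the
   quotient to be at least [cmod c + 1]. *)
pose T := Mp + Mq + r^-1 + 4 * cmod (lead_coef p) / cmod (lead_coef q) * (cmod c + 1).
have ri : 0 < r^-1 by rewrite invr_gt0.
have cc := cmod_ge0 c.
have Q0 : 0 <= 4 * cmod (lead_coef p) / cmod (lead_coef q) * (cmod c + 1).
  by rewrite mulr_ge0 ?addr_ge0 // divr_ge0 ?mulr_ge0 // ltW.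
pose t := T + 1; have t1 : 1 < t by rewrite /t /T; lra.
pose z : C := t%:C.
have tz : cmod z = t by rewrite /z cmod_realC ger0_norm //; lra.
have z0 : z != 0 by rewrite -cmod_gt0 tz; lra.
have t0 : 0 < t by lra.
have zr : cmod (z^-1 - 0) < r.
  rewrite subr0 cmodV tz -[r]invrK ltf_pV2 ?posrE //; rewrite /t /T; lra.
have [|Hp0 Hp1 _] := Hp z; first by rewrite tz /t /T; lra.
have [|Hq0 _ _] := Hq z; first by rewrite tz /t /T; lra.
have qz : 0 < cmod q.[z].
  by apply: lt_le_trans Hq0; rewrite mulr_gt0 ?divr_gt0 // exprn_gt0 // tz.
have pz : 0 < cmod p.[z].
  by apply: lt_le_trans Hp0; rewrite mulr_gt0 ?divr_gt0 // exprn_gt0 // tz.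
have zi0 : z^-1 != 0 by rewrite invr_eq0.
have := Hr _ zr zi0.
have -> : local_expr (ratmap p q) infty_pt z^-1 = q.[z] / p.[z].
  rewrite /local_expr /= qp invr_eq0 (negPf z0) invrK /= -[_ == 0]negbK.
  by rewrite -cmod_gt0 qz /= invf_div.
move=> H; have {H} : cmod (q.[z] / p.[z] / z^-1 ^+ d) < cmod c + 1.
  have := cmodD (q.[z] / p.[z] / z^-1 ^+ d - c) c; rewrite subrK; lra.
apply/negP; rewrite -leNgt.
rewrite -exprVn invrK !cmodM cmodV cmodX tz.
have td : t ^+ 2 <= t ^+ d by rewrite ler_weXn2l // ltW.
have h1 : cmod (lead_coef q) / 2 / (2 * cmod (lead_coef p) * t) <= cmod q.[z] / cmod p.[z].
  rewrite ler_pdivrMr ?mulr_gt0 // mulrAC ler_pdivlMr //.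
  rewrite tz spq exprS in Hp1 Hq0; have tn : 0 < t ^+ (size q).-1 by rewrite exprn_gt0.
  apply: (le_trans (ler_wpM2l _ Hp1)); first by rewrite divr_ge0 // ltW.
  have := ler_wpM2r (ltW (mulr_gt0 (mulr_gt0 (ltr0Sn R 1) lp) t0)) Hq0.
  lra.
apply: (@le_trans _ _ (cmod (lead_coef q) / 2 / (2 * cmod (lead_coef p) * t) * t ^+ 2)); last first.
  by rewrite ler_pM ?exprn_ge0 ?divr_ge0 ?mulr_ge0 // ltW.
have -> : cmod (lead_coef q) / 2 / (2 * cmod (lead_coef p) * t) * t ^+ 2 =
   cmod (lead_coef q) / (4 * cmod (lead_coef p)) * t.
  by field; rewrite !gt_eqF.
have : 4 * cmod (lead_coef p) / cmod (lead_coef q) * (cmod c + 1) <= t.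
  by rewrite /t /T; lra.
rewrite -(ler_pM2l (divr_gt0 lq (mulr_gt0 (ltr0Sn R 3) lp))); apply: le_trans.
rewrite le_eqVlt; apply/orP; left; apply/eqP; field.
by rewrite !gt_eqF.
Qed.

(** Hypothesis (b) appears as degree inequalities: a gap of 2 makes infinity superattracting for
    [f0], and [f1] vanishes at infinity without being identically 0. *)
Lemma transitive_of_local_data (p q p1 q1 : {poly C}) (m : C) :
  let f0 := ratmap p q in let f1 := ratmap p1 q1 in
  coprimep p q -> q != 0 -> coprimep p1 q1 -> q1 != 0 ->
  continuous f0 -> continuous f1 ->
  (size q + 2 <= size p)%N -> (size p1 < size q1)%N -> p1 != 0 ->
  fin_deriv f0 0 0 m -> 1 < cmod m ->
  (forall c, critical_point f0 c -> exists2 a, attracting_periodic f0 a &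
      (fun k : nat => iter k f0 c) @ \oo `=>` set_nbhs (forward_orbit f0 a)) ->
  (forall a, attracting_periodic f0 a -> a <> infty_pt ->
     exists k : nat, immediate_basin_infty f0 (iter k f1 a)) ->
  topologically_transitive [set g | semigroup_gen f0 f1 g].
Proof.
move=> f0 f1 cpq q0 cpq1 q10 cf0 cf1 qp pq1 p10 dm m1 Hcrit Hattr.
have qp' : (size q < size p)%N by rewrite (leq_trans _ qp) // addn2 ltnS leqnSn.
have [Ma Ma1 Ha] := superattracting_infty qp q0.
have [Mb [A [Mb1 Hb]]] := zero_at_infty pq1 p10.
pose M := Ma + Mb; have M1 : 1 <= M by rewrite /M; lra.
have MMa z : M < cmod z -> Ma < cmod z by rewrite /M; lra.
have MMb z : M < cmod z -> Mb < cmod z by rewrite /M; lra.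
have far0 (z : C) : M < cmod z ->
    exists2 w, f0 (fin_pt z) = fin_pt w & 2 * cmod z <= cmod w.
  by move=> /MMa /Ha[w [c [dw Hw _]]]; exists w => //; exact: dw.1.
have [r [l [L [B [r0 l1 L0 B0 Hrep]]]]] := repelling_zero dm m1.
have [rho rho0 Hesc] := escape_zero r0 l1 L0 B0 Hrep.
have blow := fun z => @derivative_blow_up R f0 f1 M A rho (L * rho) z M1 rho0
  (fun z Hz => Ha z (MMa z Hz)) (fun z Hz => Hb z (MMb z Hz)) Hesc.
have lift0 : homog_liftable f0 by exact: homog_liftable_ratmap.
have lift1 : homog_liftable f1 by exact: homog_liftable_ratmap.
pose z1 : C := (M + 1)%:C.
have Mz1 : M < cmod z1 by rewrite /z1 cmod_realC ger0_norm; lra.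
have pos_neq0 (w c z : C) (k : R) : 0 < k -> w != 0 -> k * cmod w <= cmod (c * z) -> c != 0.
  move=> k0 w0; apply: contraTneq => ->; rewrite mul0r cmod0 -ltNge.
  by rewrite mulr_gt0 // cmod_gt0.
have gen0 : exists z, q.[z] != 0 /\ quot_deriv p q z != 0.
  have [w [c [dw Hw Hc]]] := Ha _ (MMa _ Mz1); exists z1.
  have qz : q.[z1] != 0.
    by apply/eqP => qz; have [] := dw; rewrite ratmap_homog /homog_pt qz eqxx => E; discriminate E.
  split=> //; have [_ <-] := fin_deriv_unique dw (fin_deriv_ratmap p qz).
  have w0 : w != 0 by rewrite -cmod_gt0; lra.
  by apply: (pos_neq0 w c z1 (3 / 2) _ w0 Hc); rewrite divr_gt0.
have gen1 : exists z, q1.[z] != 0 /\ quot_deriv p1 q1 z != 0.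
  have [w [c [dw w0 _ Hc]]] := Hb _ (MMb _ Mz1); exists z1.
  have qz : q1.[z1] != 0.
    by apply/eqP => qz; have [] := dw; rewrite ratmap_homog /homog_pt qz eqxx => E; discriminate E.
  split=> //; have [_ <-] := fin_deriv_unique dw (fin_deriv_ratmap p1 qz).
  by apply: (pos_neq0 w c z1 2^-1); rewrite ?invr_gt0.
have [zg [qzg dzg]] := gen0; have [zh [qzh dzh]] := gen1.
have d0 : generic_deriv f0 by exact: generic_deriv_ratmap qzg dzg.
have d1 : generic_deriv f1 by exact: generic_deriv_ratmap qzh dzh.
have W0 : wronskian p q != 0.
  by apply: contraNneq dzg; rewrite quot_derivE => ->; rewrite horner0 mul0r.
have finf : f0 infty_pt = infty_pt by exact: ratmap_infty.
have [s Hs] := poly_roots W0.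
have [|N [tN iN HN]] := @critical_trap R p q f1 M qp' far0 M1 s.
  (* A root of the Wronskian at which [q] vanishes is a multiple pole, with critical value
     infinity. *)
  move=> c; rewrite -Hs => Wc; have [qc|qc] := eqVneq q.[c] 0.
    exists (trap_infty M); first exact: (trap_inftyP _ finf far0 M1).
    rewrite ratmap_homog /homog_pt qc eqxx; exact: (@nbhs_trap_infty _ M infty_pt).
  have [|a attr conv] := Hcrit (fin_pt c).
    rewrite /critical_point (fin_deriv_sphere_deriv (fin_deriv_ratmap p qc)).
    by rewrite quot_derivE (eqP Wc) mul0r.
  have [N tN aN] := trap_of_attracting cf0 cf1 qp' far0 M1 attr (Hattr a attr).
  have [k kN] := attracted_meets_trap cf0 cf1 attr aN conv.
  (* The critical point enters [N] after [k] steps, hence lies in the enlarged trap, and its image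
     is interior to that trap. *)
  have tN' := trap_preimage cf0 cf1 k tN.
  exists (iter k f0 @^-1` N) => //; case: tN' => _ fN _; apply: fN.
  exact: nbhs_singleton kN.
move=> U V oU oV U0 V0.
have [u Uu] := open_fin_pt oU U0; have [v Vv] := open_fin_pt oV V0.
have /nbhs_fin_ptP[ru ru0 HU] : nbhs (fin_pt u) U by exact: open_nbhs_nbhs.
have /nbhs_fin_ptP[rv rv0 HV] : nbhs (fin_pt v) V by exact: open_nbhs_nbhs.
apply: contrapT => Hno.
have {}Hno g x : semigroup_gen f0 f1 g -> U x -> ~ V (g x).
  by move=> Gg Ux Vgx; apply: Hno; exists g => //; exists (g x); split=> //; exists x.
(* A normality bound: on [U] every element of the semigroup omits the disc of radius [rv] around
   [v], so a bound on its value bounds its derivative. *)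
have marty z (e : R) g w c (b : R) : 0 < e ->
    (forall t, cmod (t - z) <= e -> U (fin_pt t)) -> semigroup_gen f0 f1 g ->
    fin_deriv g z w c -> cmod w <= b -> cmod c <= (b + cmod v) ^+ 2 / (e * rv).
  move=> e0 Ue Gg dg wb.
  have lg : homog_liftable g.
    by have [] := generic_word lift0 lift1 d0 d1 (or_intror Gg).
  rewrite ler_pdivlMr ?mulr_gt0 //.
  have H : cmod c * (e * rv) <= cmod (w - v) ^+ 2.
    apply: (omitted_disc_deriv_le lg e0 rv0 dg) => t x tz gt.
    rewrite leNgt; apply/negP => xv.
    by apply: (Hno g (fin_pt t) Gg (Ue t tz)); rewrite gt; exact: HV.
  apply: (le_trans H); have b0 : 0 <= b := le_trans (cmod_ge0 w) wb.
  rewrite lerXn2r ?nnegrE ?addr_ge0 ?cmod_ge0 // (le_trans (cmodBD _ _)) //.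
  by rewrite lerD2r.
have [[z [j [zu Nz]]]|none] := pselect (exists z j, cmod (z - u) < ru /\ N (iter j f0 (fin_pt z))).
  have [g wg Mg] : exists2 g, word f0 f1 g & far M (g (iter j f0 (fin_pt z))).
    by case: tN => _ _; apply.
  pose h := g \o iter j f0.
  have wh : word f0 f1 h by apply: word_comp => //; exact: word_iter0.
  have /nbhs_fin_ptP[e e0 He] : nbhs (fin_pt z) (h @^-1` far M).
    apply: nbhs_preimage; first exact: (continuous_word cf0 cf1 wh).
    exact: nbhs_far.
  (* The point [z] is moved to a nearby [t] where [h] has a nonzero derivative [b]; dividing the
     threshold passed to [blow] by [cmod b] compensates for this factor. *)
  have [_ [sh Hsh]] := generic_word lift0 lift1 d0 d1 wh.
  pose e' := Num.min e (ru - cmod (z - u)).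
  have e'0 : 0 < e' by rewrite lt_min e0 subr_gt0.
  have [t tsh te] := exists_notin sh z e'0.
  have [w [b [dw b0]]] := Hsh t tsh.
  have te1 : cmod (t - z) < e by apply: lt_le_trans te _; rewrite ge_min lexx.
  have te2 : cmod (t - z) < ru - cmod (z - u).
    by apply: lt_le_trans te _; rewrite ge_min lexx orbT.
  have Mw : M < cmod w by have := He t te1; rewrite /= [h _]dw.1.
  have tu : cmod (t - u) < ru by have := cmod_tri t z u; lra.
  pose d := (ru - cmod (t - u)) / 2; have d0' : 0 < d by rewrite divr_gt0 // subr_gt0.
  have Ud x : cmod (x - t) <= d -> U (fin_pt x).
    by move=> xt; apply: HU; have := cmod_tri x t u; rewrite /d in xt; lra.
  have cb : 0 < cmod b by rewrite cmod_gt0.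
  have [k [i [x [c [dx xL Kc]]]]] :=
    blow w Mw ((L * rho + cmod v) ^+ 2 / (d * rv) / cmod b).
  have G : semigroup_gen f0 f1 ((iter k f0 \o f1 \o iter i f0) \o h).
    apply: semigroup_gen_compr => //; apply: semigroup_gen_compr; last exact: word_iter0.
    by apply: semigroup_gen_compl; [exact: word_iter0|exact: SemigroupGen1].
  have := marty t d _ x (c * b) (L * rho) d0' Ud G (fin_deriv_comp dw dx) xL.
  by rewrite cmodM -ler_pdivlMr // leNgt Kc.
have ru2 : 0 < ru / 2 by rewrite divr_gt0.
have Uru t : cmod (t - u) <= ru / 2 -> U (fin_pt t).
  by move=> tu; apply: HU; lra.
(* The added 1 covers the iterate of exponent 0, the identity, to which [marty] is not applied. *)
pose K := (M + 1 + cmod v) ^+ 2 / (ru / 2 * rv) + 1.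
have K1 : 1 <= K.
  by rewrite lerDr divr_ge0 ?sqr_ge0 // mulr_ge0 // ltW.
apply: (@escapes_or_unbounded_deriv R p q f1 M cf0 qp' M1 N u K) => //.
- by move=> c rc; apply: HN; rewrite -Hs.
- by move=> n Nn; apply: none; exists u, n; rewrite subrr cmod0.
- move=> [|n] w c dn wM.
    have [_ ->] := fin_deriv_unique dn (fin_deriv_id u).
    by rewrite cmod1.
  have G : semigroup_gen f0 f1 (iter n.+1 f0).
    apply: (semigroup_gen_compr (g := f0) (h := iter n f0)); first exact: SemigroupGen0.
    exact: word_iter0.
  have := marty u (ru / 2) _ w c (M + 1) ru2 Uru G dn wM.
  by rewrite /K; lra.
Qed.

End Transitivity.

(** * Reading the degree conditions off the hypotheses at a fixed parameter *)

Theorem lemma2p1 (R : realType) (f0 f1 : R[i] -> sphere R -> sphere R)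
    (p0 p1 : R)
    (Hf0 : analytic_rational_family f0)
    (Hf1 : analytic_rational_family f1)
    (Hp0 : 0 < p0 < 1) (Hp1 : 0 < p1 < 1) (Hp : p0 + p1 = 1)
    (Ha : forall l : R[i], `|l| < 1 ->
       [/\ f0 l (fin_pt 0) = fin_pt 0,
           f1 l (fin_pt 0) = fin_pt 0,
           1 < `|sphere_deriv (f0 l) (fin_pt 0)| &
           `|sphere_deriv (f1 l) (fin_pt 0)| < 1])
    (Hb : forall l : R[i], `|l| < 1 ->
       [/\ superattracting_fixed (f0 l) infty_pt,
           exists2 d : nat, (2 <= d)%N & local_degree (f0 l) infty_pt d &
           f1 l infty_pt = fin_pt 0])
    (Hc : forall l : R[i], `|l| < 1 ->
       hyperbolic (f0 l) /\
       forall a, attracting_periodic (f0 l) a -> a <> infty_pt ->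
         exists k : nat, immediate_basin_infty (f0 l) (iter k (f1 l) a))
    (Hd : forall l : R[i], `|l| < 1 ->
       (0 < p0%:E * lne (complex.Re `|sphere_deriv (f0 l) (fin_pt 0)|)%:E
            + p1%:E * lne (complex.Re `|sphere_deriv (f1 l) (fin_pt 0)|)%:E)%E) :
  forall l : R[i], `|l| < 1 ->
    topologically_transitive [set g | semigroup_gen (f0 l) (f1 l) g].
Proof.
move=> l l1.
have cont (F : R[i] -> sphere R -> sphere R) : analytic_rational_family F ->
    continuous (F l).
  move=> [_ HF] a; have [cF _] := HF l a l1.
  have cp : {for a, continuous (fun x : sphere R => (l, x))}.
    move=> A [[A1 A2] [/= HA1 HA2] HA]; apply: filterS HA2 => x A2x.
    by apply: (HA (l, x)); split=> //=; exact: nbhs_singleton HA1.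
  exact: (continuous_comp cp cF).
have cf0 := cont _ Hf0; have cf1 := cont _ Hf1.
have [f00 f10 mu _] := Ha l l1.
have [[finf _] [d d2 ld] f1inf] := Hb l l1.
have [[[n _ [p [q [cpq q0 E0 _]]]] Hcrit] Hattr] := Hc l l1.
have [n1 [r [s [crs s0 E1 _]]]] := Hf1.1 l l1.
move: (Hd l l1) => Hdl.
rewrite E0 in cf0 f00 mu finf ld Hcrit Hattr Hdl *.
rewrite E1 in cf1 f10 f1inf Hattr Hdl *.
have qp : (size q < size p)%N by move: finf => /=; case: ltnP.
have q00 : q.[0] != 0 by apply/eqP => E; move: f00; rewrite /= E eqxx.
have s00 : s.[0] != 0 by apply/eqP => E; move: f10; rewrite /= E eqxx.
have dq := fin_deriv_ratmap p q00; have ds := fin_deriv_ratmap r s00.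
have p00 : p.[0] / q.[0] = 0 by move: f00; rewrite /= (negPf q00) => -[].
rewrite p00 in dq.
(* If [r = 0], the multiplier of [f1] at 0 is 0, and its logarithm makes the sum in (d) minus
   infinity. *)
have r0 : r != 0.
  apply: contraTneq Hdl => r0; rewrite (fin_deriv_sphere_deriv ds) r0.
  rewrite /quot_deriv derivC !horner0 mul0r mul0r subrr mul0r normr0 /=.
  rewrite lexx gt0_muleNy ?addeNy -?leNgt ?leNye // lte_fin.
  by case/andP: Hp1.
(* A finite value at infinity gives [size r <= size s]; equality would make that value a quotient of
   nonzero leading coefficients. *)
have rs : (size r < size s)%N.
  move: f1inf => /=; case: ltnP => // sr [] /eqP.
  rewrite mulf_eq0 invr_eq0 lead_coef_eq0 (negPf s0) orbF => rn.
  rewrite ltn_neqAle sr andbT; apply: contraTneq rn => <-.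
  by rewrite -/(lead_coef r) lead_coef_eq0.
apply: (transitive_of_local_data cpq q0 crs s0 cf0 cf1 _ rs r0 dq) => //.
  exact: local_degree_size qp q0 d2 ld.
by move: mu; rewrite (fin_deriv_sphere_deriv dq) cmodE -[1]/(1%:C) ltcR.
Qed.
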